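(* Let $A=\{a_1,a_2,\dots\}$ be a countable alphabet, let $H$ be a tame subgroup of the big free group $BF(A)$, let $G$ be a compact Hausdorff topological group, and let $f:H\to G$ be a group homomorphism. Then $f$ extends to a group homomorphism $BF(A)\to G$, i.e. there is a group homomorphism $F:BF(A)\to G$ with $F|_H=f$.
   Context: Transfinite words. Let $A=\{a_1,a_2,\dots\}$ be a countable set and $A^{-1}$ the set of formal inverses of its elements (with $(a^{-1})^{-1}=a$). A transfinite word over $A$ is a map $w:S\to A\cup A^{-1}$, where $S$ is a countable linearly ordered set, such that the preimage of every element of $A\cup A^{-1}$ is finite. Two words $w_1:S_1\to A\cup A^{-1}$ and $w_2:S_2\to A\cup A^{-1}$ are identified if there is an order-preserving bijection $\phi:S_1\to S_2$ with $w_1=w_2\circ \phi$. The product $w_1w_2$ is the concatenation: its domain is the disjoint union of $S_1$ and $S_2$ with every element of $S_1$ preceding every element of $S_2$. Cancellation. Write $[a,b]_S=\{s\in S: a\le s\le b\}$. A word $w:S\to A\cup A^{-1}$ admits a cancellation if there are a nonempty subset $T\subseteq S$ and a map $\ast:T\to T$ such that for all $t\in T$: $\ast$ is an involution; $[t,t^\ast]_S=[t,t^\ast]_T$; $[t,t^\ast]_T=([t,t^\ast]_T)^\ast$; and $w(t^\ast)=w(t)^{-1}$. The word $w|_{S\setminus T}$ is said to arise from $w$ by a cancellation. A word is reduced if it admits no cancellation. Words related by cancellations are considered equivalent. It is known that each equivalence class contains a unique reduced word and that the equivalence classes form a group under concatenation; this is the big free group $BF(A)$. Elements of $BF(A)$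 are identified with their reduced representatives. Tame subgroups. A subword of a word $w:S\to A\cup A^{-1}$ is the restriction of $w$ to a set of the form $[a,b]_S$. A subgroup $H$ of $BF(A)$ is tame if for every reduced word $w\in H$, every subword of $w$ is also in $H$. *)

(* Defs.v *)
From HB Require Import structures.
From mathcomp Require Import all_boot all_order interval.
From mathcomp Require Import all_classical topology.

Set Implicit Arguments.
Unset Strict Implicit.
Unset Printing Implicit Defensive.
Import Order.TTheory.
Local Open Scope classical_set_scope.
Local Open Scope quotient_scope.

(* [(a, false)] is the letter a and [(a, true)] its formal inverse. *)
Definition letter (A : Type) : Type := (A * bool)%type.
Definition linv (A : Type) (l : letter A) : letter A := (l.1, ~~ l.2).

Lemma linvK A : involutive (@linv A).
Proof. by case=> a b; rewrite /linv /= negbK. Qed.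

(* Taking the domain in [Set] is no restriction, since it is countable; it
   keeps the type of all words, hence BF(A), in a low universe. *)
Record word (A : Type) := Word {
  wdom : Set;
  wle : rel wdom;
  wlab : wdom -> letter A;
  wle_anti : antisymmetric wle;
  wle_trans : transitive wle;
  wle_total : total wle;
  wdom_countable : countable [set: wdom];
  wlab_finite : forall l, finite_set (wlab @^-1` [set l]) }.

Arguments wle {A} w : rename.
Arguments wlab {A} w : rename.

Section WordOrder.
Variables (A : Type) (w : word A).

Lemma wle_refl : reflexive (wle w).
Proof. by move=> x; have := wle_total x x; rewrite orbb. Qed.

HB.instance Definition _ := gen_eqMixin (wdom w).
HB.instance Definition _ := gen_choiceMixin (wdom w).
HB.instance Definition _ := Order.Le_isPOrder.Build Order.default_display
  (wdom w) wle_refl (@wle_anti A w) (@wle_trans A w).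
HB.instance Definition _ := Order.POrder_isTotal.Build Order.default_display
  (wdom w) (@wle_total A w).
End WordOrder.

(* Words are identified up to isomorphism; this is built into [wequiv]. *)
Definition wiso A (w1 w2 : word A) : Prop :=
  exists phi : wdom w1 -> wdom w2,
    [/\ bijective phi,
        {mono phi : x y / (x <= y)%O} &
        forall x, wlab w1 x = wlab w2 (phi x)].

Section Restriction.
Variables (A : Type) (w : word A) (D : set (wdom w)).
Let dom : Set := {s : wdom w | s \in D}.
Let le : rel dom := fun x y => (val x <= val y)%O.
Let lab (x : dom) : letter A := wlab w (val x).

Let le_anti : antisymmetric le.
Proof. by move=> x y /le_anti /val_inj. Qed.
Let le_trans : transitive le.
Proof. by move=> y x z; exact: le_trans. Qed.
Let le_total : total le.
Proof. by move=> x y; exact: le_total. Qed.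
Let dom_countable : countable [set: dom].
Proof.
have /countable_injP[f finj] := wdom_countable w.
apply/countable_injP; exists (f \o val) => x y _ _ /= e.
by apply/val_inj/finj => //; rewrite inE.
Qed.
Let lab_finite l : finite_set (lab @^-1` [set l]).
Proof.
have fin : finite_set (val @` (lab @^-1` [set l])).
  by apply: (sub_finite_set _ (@wlab_finite A w l)) => _ [x + <-].
by move: fin; rewrite (eq_finite_set (inj_card_eq _)) // => x y _ _ /val_inj.
Qed.

Definition wrestr : word A :=
  Word le_anti le_trans le_total dom_countable lab_finite.
End Restriction.

Definition subword A (w : word A) (a b : wdom w) : word A :=
  wrestr `[a, b]%classic.

(* The map * : T -> T is represented by a map on the whole of S, whose values
   outside T are irrelevant.  The interval [t, t*]_S is empty when
   t* < t; the conditions are then carried by the partner t* of t. *)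
Definition cancellation A (w : word A) (T : set (wdom w))
    (star : wdom w -> wdom w) : Prop :=
  T !=set0 /\ forall t, T t ->
    [/\ T (star t) /\ star (star t) = t,
        `[t, star t] = T `&` `[t, star t],
        T `&` `[t, star t] = star @` (T `&` `[t, star t]) &
        wlab w (star t) = linv (wlab w t)].

Definition reduced A (w : word A) : Prop :=
  ~ exists T star, @cancellation A w T star.

(* Words are equivalent when they are related by a finite chain of
   isomorphisms and of cancellations performed in either direction. *)
Inductive wequiv A : word A -> word A -> Prop :=
| wequiv_iso w1 w2 : wiso w1 w2 -> wequiv w1 w2
| wequiv_cancel w T star : @cancellation A w T star -> wequiv w (wrestr (~` T))
| wequiv_sym w1 w2 : wequiv w1 w2 -> wequiv w2 w1
| wequiv_trans w1 w2 w3 : wequiv w1 w2 -> wequiv w2 w3 -> wequiv w1 w3.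

Section EmptyWord.
Variable A : Type.
Let lab (x : void) : letter A := match x with end.
Let le (x y : void) : bool := true.
Let le_anti : antisymmetric le. Proof. by case. Qed.
Let le_trans : transitive le. Proof. by case. Qed.
Let le_total : total le. Proof. by case. Qed.
Let lab_finite l : finite_set (lab @^-1` [set l]).
Proof. by apply: (sub_finite_set _ (finite_set0 _)); case. Qed.

Definition wempty : word A :=
  Word le_anti le_trans le_total (countableP _) lab_finite.
End EmptyWord.

Section Concatenation.
Variables (A : Type) (w1 w2 : word A).
Let dom : Set := (wdom w1 + wdom w2)%type.
Let le : rel dom := fun x y =>
  match x, y with
  | inl x, inl y => (x <= y)%O
  | inl _, inr _ => true
  | inr _, inl _ => false
  | inr x, inr y => (x <= y)%O
  end.
Let lab (x : dom) : letter A :=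
  match x with inl x => wlab w1 x | inr x => wlab w2 x end.

Let le_anti : antisymmetric le.
Proof. by case=> x [] y //= /le_anti ->. Qed.
Let le_trans : transitive le.
Proof. by case=> y [] x [] z //=; exact: le_trans. Qed.
Let le_total : total le.
Proof. by case=> x [] y //=; exact: le_total. Qed.
Let dom_countable : countable [set: dom].
Proof.
have /countable_injP[f finj] := wdom_countable w1.
have /countable_injP[g ginj] := wdom_countable w2.
apply/countable_injP.
exists (fun x => match x with inl x => (f x).*2 | inr y => (g y).*2.+1 end).
case=> x [] y _ _ e.
- by congr inl; apply: finj; rewrite ?inE //; exact: double_inj.
- by have := congr1 odd e; rewrite /= !odd_double.
- by have := congr1 odd e; rewrite /= !odd_double.
- by congr inr; apply: ginj; rewrite ?inE //; apply: double_inj; case: e.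
Qed.
Let lab_finite l : finite_set (lab @^-1` [set l]).
Proof.
apply: (@sub_finite_set _ _ (inl @` (wlab w1 @^-1` [set l]) `|`
    inr @` (wlab w2 @^-1` [set l]))).
  by case=> x e; [left|right]; exists x.
by rewrite finite_setU; split; apply: finite_image; exact: wlab_finite.
Qed.

Definition wcat : word A :=
  Word le_anti le_trans le_total dom_countable lab_finite.
End Concatenation.

Section Inverse.
Variables (A : Type) (w : word A).
Let le : rel (wdom w) := fun x y => (y <= x)%O.
Let lab (x : wdom w) : letter A := linv (wlab w x).

Let le_anti : antisymmetric le.
Proof. by move=> x y; rewrite andbC => /le_anti. Qed.
Let le_trans : transitive le.
Proof. by move=> y x z xy yz; exact: le_trans yz xy. Qed.
Let le_total : total le.
Proof. by move=> x y; exact: le_total. Qed.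
Let lab_finite l : finite_set (lab @^-1` [set l]).
Proof.
apply: (sub_finite_set _ (@wlab_finite A w (linv l))) => x /= <-.
by rewrite linvK.
Qed.

Definition winv : word A :=
  Word le_anti le_trans le_total (wdom_countable w) lab_finite.
End Inverse.

Section EquivalenceTheory.
Variable A : Type.
Implicit Types u v w : word A.

Lemma in_witv w (a b x : wdom w) :
  `[a, b]%classic x = (wle w a x && wle w x b) :> Prop.
Proof. by rewrite /= in_itv. Qed.

Lemma wequiv_refl w : wequiv w w.
Proof.
by apply: wequiv_iso; exists id; split => //; exists id.
Qed.

Lemma wcat_congr u u' v v' :
  wequiv u u' -> wequiv v v' -> wequiv (wcat u v) (wcat u' v').
Proof.
move=> uu' vv'; apply: (@wequiv_trans _ _ (wcat u' v)).
  elim: uu' => {u u' vv'} [u u'|u T star [[t0 Tt0] cT]|u u' _ uu'|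
      u1 u2 u3 _ u12 _ u23].
  - case=> phi [[psi phiK psiK] mono lab]; apply: wequiv_iso.
    exists (fun x => match x with inl x => inl (phi x) | inr y => inr y end).
    split; last by case.
      exists (fun x => match x with inl x => inl (psi x) | inr y => inr y end).
        by case=> x //; rewrite phiK.
      by case=> x //; rewrite psiK.
    by case=> x [] y //; exact: mono.
  - pose T' : set (wdom (wcat u v)) :=
      fun x => match x with inl x => T x | inr _ => False end.
    pose star' (x : wdom (wcat u v)) : wdom (wcat u v) :=
      match x with inl x => inl (star x) | inr y => inr y end.
    have cT' : cancellation T' star'.
      split; first by exists (inl t0).
      case=> // t Tt; have [[Tst sst] E1 E2 lab] := cT _ Tt.
      split => //; first by rewrite /= sst.
        apply/seteqP; split => [x itx|x []//]; split => //.
        case: x itx => x; rewrite in_witv //= ?andbF //.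
        move=> itx; have : `[t, star t]%classic x by rewrite in_witv.
        by rewrite E1 => -[].
      apply/seteqP; split.
        case=> x [Tx itx] //.
        have : (T `&` `[t, star t]) x by split.
        rewrite E2 => -[y [Ty ity] yx].
        by exists (inl y); [split|rewrite /= yx].
      move=> _ [[] x [Tx itx] <-] //.
      have : (star @` (T `&` `[t, star t])) (star x) by exists x.
      by rewrite -E2 => -[? ?]; split.
    apply: wequiv_trans (wequiv_cancel cT') _; apply: wequiv_iso.
    have TC x : inl x \in ~` T' -> x \in ~` T.
      by move=> /set_mem h; apply/mem_set.
    have TC' x : x \in ~` T -> (inl x : wdom (wcat u v)) \in ~` T'.
      by move=> /set_mem h; apply/mem_set.
    have TCr y : (inr y : wdom (wcat u v)) \in ~` T'.
      by apply/mem_set => -[].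
    pose phi (x : wdom (wrestr (~` T'))) : wdom (wcat (wrestr (~` T)) v) :=
      match x with
      | exist (inl x) h => inl (exist _ x (TC x h))
      | exist (inr y) h => inr y
      end.
    pose psi (x : wdom (wcat (wrestr (~` T)) v)) : wdom (wrestr (~` T')) :=
      match x with
      | inl (exist x h) => exist _ (inl x) (TC' x h)
      | inr y => exist _ (inr y) (TCr y)
      end.
    exists phi; split.
    + exists psi.
        by case=> -[x|y] h; apply: val_inj.
      by case=> [[x h]|y] //; congr inl; apply: val_inj.
    + by case=> -[x|x] hx [[y|y] hy].
    + by case=> -[x|x] hx.
  - exact: wequiv_sym.
  - exact: wequiv_trans u12 u23.
elim: vv' => {v v' uu'} [v v'|v T star [[t0 Tt0] cT]|v v' _ vv'|
    v1 v2 v3 _ v12 _ v23].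
- case=> phi [[psi phiK psiK] mono lab]; apply: wequiv_iso.
  exists (fun x => match x with inl x => inl x | inr y => inr (phi y) end).
  split; last by case.
    exists (fun x => match x with inl x => inl x | inr y => inr (psi y) end).
      by case=> x //; rewrite phiK.
    by case=> x //; rewrite psiK.
  by case=> x [] y //; exact: mono.
- pose T' : set (wdom (wcat u' v)) :=
    fun x => match x with inl _ => False | inr x => T x end.
  pose star' (x : wdom (wcat u' v)) : wdom (wcat u' v) :=
    match x with inl x => inl x | inr y => inr (star y) end.
  have cT' : cancellation T' star'.
    split; first by exists (inr t0).
    case=> // t Tt; have [[Tst sst] E1 E2 lab] := cT _ Tt.
    split => //; first by rewrite /= sst.
      apply/seteqP; split => [x itx|x []//]; split => //.
      case: x itx => x; rewrite in_witv //= ?andbF //.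
      move=> itx; have : `[t, star t]%classic x by rewrite in_witv.
      by rewrite E1 => -[].
    apply/seteqP; split.
      case=> x [Tx itx] //.
      have : (T `&` `[t, star t]) x by split.
      rewrite E2 => -[y [Ty ity] yx].
      by exists (inr y); [split|rewrite /= yx].
    move=> _ [[] x [Tx itx] <-] //.
    have : (star @` (T `&` `[t, star t])) (star x) by exists x.
    by rewrite -E2 => -[? ?]; split.
  apply: wequiv_trans (wequiv_cancel cT') _; apply: wequiv_iso.
  have TC x : inr x \in ~` T' -> x \in ~` T.
    by move=> /set_mem h; apply/mem_set.
  have TC' x : x \in ~` T -> (inr x : wdom (wcat u' v)) \in ~` T'.
    by move=> /set_mem h; apply/mem_set.
  have TCl y : (inl y : wdom (wcat u' v)) \in ~` T'.
    by apply/mem_set => -[].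
  pose phi (x : wdom (wrestr (~` T'))) : wdom (wcat u' (wrestr (~` T))) :=
    match x with
    | exist (inl y) h => inl y
    | exist (inr x) h => inr (exist _ x (TC x h))
    end.
  pose psi (x : wdom (wcat u' (wrestr (~` T)))) : wdom (wrestr (~` T')) :=
    match x with
    | inl y => exist _ (inl y) (TCl y)
    | inr (exist x h) => exist _ (inr x) (TC' x h)
    end.
  exists phi; split.
  + exists psi.
      by case=> -[x|y] h; apply: val_inj.
    by case=> [y|[x h]] //; congr inr; apply: val_inj.
  + by case=> -[x|x] hx [[y|y] hy].
  + by case=> -[x|x] hx.
- exact: wequiv_sym.
- exact: wequiv_trans v12 v23.
Qed.

Lemma winv_congr u v : wequiv u v -> wequiv (winv u) (winv v).
Proof.
elim=> {u v} [u v|u T star [[t0 Tt0] cT]|u v _ uv|u v w _ uv _ vw].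
- case=> phi [bij mono lab]; apply: wequiv_iso; exists phi; split => //.
    by move=> x y; exact: mono.
  by move=> x; rewrite /= lab.
- have itE (a b : wdom (winv u)) :
      `[a, b]%classic = `[(b : wdom u), (a : wdom u)]%classic :> set (wdom u).
    by rewrite predeqE => x; rewrite (@in_witv (winv u)) (@in_witv u) /= andbC.
  have cT' : @cancellation _ (winv u) T star.
    split; first by exists t0.
    move=> t Tt; have [[Tst sst] _ _ _] := cT _ Tt.
    have [_ E1 E2 lab] := cT _ Tst.
    rewrite !itE; rewrite sst in E1 E2 lab.
    split => //=.
    by rewrite lab linvK.
  apply: wequiv_trans (wequiv_cancel cT') _; apply: wequiv_iso.
  by exists id; split => //; exists id.
- exact: wequiv_sym.
- exact: wequiv_trans uv vw.
Qed.

Lemma wcatA u v w : wequiv (wcat u (wcat v w)) (wcat (wcat u v) w).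
Proof.
apply: wequiv_iso.
exists (fun x : wdom u + (wdom v + wdom w) => match x with
  | inl x => inl (inl x) | inr (inl x) => inl (inr x) | inr (inr x) => inr x
  end).
split; [|by case=> [x|[x|x]] [y|[y|y]]|by case=> [x|[x|x]]].
exists (fun x : wdom u + wdom v + wdom w => match x with
  | inl (inl x) => inl x | inl (inr x) => inr (inl x) | inr x => inr (inr x)
  end).
  by case=> [x|[x|x]].
by case=> [[x|x]|x].
Qed.

Lemma wcat0w w : wequiv (wcat (wempty A) w) w.
Proof.
apply: wequiv_iso.
exists (fun x : void + wdom w => match x with
  | inl x => match x with end | inr x => x end).
split; [|by case=> [[]|x] [[]|y]|by case=> [[]|x]].
by exists inr => //; case=> [[]|x].
Qed.

Lemma wcatw0 w : wequiv (wcat w (wempty A)) w.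
Proof.
apply: wequiv_iso.
exists (fun x : wdom w + void => match x with
  | inl x => x | inr x => match x with end end).
split; [|by case=> [x|[]] [y|[]]|by case=> [x|[]]].
by exists inl => //; case=> [x|[]].
Qed.

Lemma wcatwV w : wequiv (wcat w (winv w)) (wempty A).
Proof.
have iso0 u : (wdom u -> False) -> wequiv u (wempty A).
  move=> u0; apply: wequiv_iso; exists (fun x => match u0 x with end).
  split; [|by move=> x; have := u0 x|by move=> x; have := u0 x].
  by exists (fun x : void => match x with end) => x; [case: (u0 x)|case: x].
have [[x0]|w0] := pselect (inhabited (wdom w)); last first.
  by apply: iso0 => -[] x; apply: w0.
pose star (x : wdom (wcat w (winv w))) : wdom (wcat w (winv w)) :=
  match x with inl x => inr x | inr x => inl x end.
have cT : cancellation setT star.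
  split; first by exists (inl x0).
  move=> t _; split.
  - by split=> //; case: t.
  - by rewrite setTI.
  - rewrite !setTI; case: t => t; apply/seteqP; split.
    + case=> x; rewrite in_witv => h; [exists (inr x)|exists (inl x)] => //;
        by rewrite in_witv; move: h; rewrite /= ?andbT.
    + by move=> _ [[] x + <-]; rewrite !in_witv /= ?andbT.
    + by case=> x; rewrite in_witv /= ?andbF.
    + by move=> _ [[] x + <-]; rewrite !in_witv /= ?andbF.
  - by case: t => t //=; rewrite linvK.
apply: wequiv_trans (wequiv_cancel cT) _.
by apply: iso0 => -[x] /set_mem; rewrite setCT.
Qed.

Lemma winvK w : wequiv (winv (winv w)) w.
Proof.
apply: wequiv_iso; exists id; split => //; first by exists id.
by move=> x; rewrite /= linvK.
Qed.

Lemma wcatVw w : wequiv (wcat (winv w) w) (wempty A).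
Proof.
apply: wequiv_trans (wcatwV (winv w)).
by apply: wcat_congr; [exact: wequiv_refl|apply: wequiv_sym; exact: winvK].
Qed.

HB.instance Definition _ := gen_eqMixin (word A).
HB.instance Definition _ := gen_choiceMixin (word A).

Definition wequivb : rel (word A) := fun u v => `[< wequiv u v >].

Lemma wequivb_equiv : equiv_class_of wequivb.
Proof.
split.
- by move=> w; apply/asboolP; exact: wequiv_refl.
- by move=> u v; apply/asboolP/asboolP; exact: wequiv_sym.
- move=> v u w /asboolP uv /asboolP vw; apply/asboolP.
  exact: wequiv_trans uv vw.
Qed.

Canonical wequivb_rel := EquivRelPack wequivb_equiv.

(* BF(A): classes of words; no choice of reduced representatives is needed to
   define the group. *)
Definition BF := {eq_quot wequivb_rel}.
HB.instance Definition _ := Choice.on BF.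
HB.instance Definition _ := EqQuotient.on BF.

Lemma BF_eqP u v : (\pi_BF u = \pi_BF v) <-> wequiv u v.
Proof. by split=> [/eqmodP/asboolP|uv] //; apply/eqmodP/asboolP. Qed.

Lemma wequiv_repr w : wequiv (repr (\pi_BF w)) w.
Proof. by apply/BF_eqP; rewrite reprK. Qed.

Definition BFmul (x y : BF) : BF := \pi_BF (wcat (repr x) (repr y)).
Definition BFone : BF := \pi_BF (wempty A).
Definition BFinv (x : BF) : BF := \pi_BF (winv (repr x)).

Lemma BFmul_pi u v : BFmul (\pi_BF u) (\pi_BF v) = \pi_BF (wcat u v).
Proof. by apply/BF_eqP/wcat_congr; exact: wequiv_repr. Qed.

Lemma BFinv_pi u : BFinv (\pi_BF u) = \pi_BF (winv u).
Proof. by apply/BF_eqP/winv_congr; exact: wequiv_repr. Qed.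

Lemma BFmulA : associative BFmul.
Proof.
elim/quotW=> u; elim/quotW=> v; elim/quotW=> w.
rewrite (BFmul_pi v w) (BFmul_pi u v) (BFmul_pi u (wcat v w)).
by rewrite (BFmul_pi (wcat u v) w); apply/BF_eqP; exact: wcatA.
Qed.
Lemma BFmul1g : left_id BFone BFmul.
Proof. by elim/quotW=> u; rewrite BFmul_pi; apply/BF_eqP/wcat0w. Qed.
Lemma BFmulg1 : right_id BFone BFmul.
Proof. by elim/quotW=> u; rewrite BFmul_pi; apply/BF_eqP/wcatw0. Qed.
Lemma BFmulVg : left_inverse BFone BFinv BFmul.
Proof.
by elim/quotW=> u; rewrite BFinv_pi BFmul_pi; apply/BF_eqP/wcatVw.
Qed.
Lemma BFmulgV : right_inverse BFone BFinv BFmul.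
Proof.
by elim/quotW=> u; rewrite BFinv_pi BFmul_pi; apply/BF_eqP/wcatwV.
Qed.

HB.instance Definition _ :=
  isGroup.Build BF BFmulA BFmul1g BFmulg1 BFmulVg BFmulgV.
End EquivalenceTheory.

(* A word belongs to H when its class does.  For a reduced word this is the
   usual identification with an element of BF(A). *)
Definition tame A (H : {pred BF A}) : Prop :=
  forall w : word A, reduced w -> \pi_(BF A) w \in H ->
  forall a b : wdom w, \pi_(BF A) (subword a b) \in H.

HB.structure Definition PreTopologicalGroup := {G of Topological G & Group G}.

HB.mixin Record PreTopologicalGroup_isTopologicalGroup G
    of PreTopologicalGroup G := {
  mulg_continuous : continuous (fun x : G * G => (x.1 * x.2)%g);
  invg_continuous : continuous (fun x : G => (x^-1)%g) }.

#[short(type="topologicalGroupType")]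
HB.structure Definition TopologicalGroup :=
  {G of PreTopologicalGroup_isTopologicalGroup G & PreTopologicalGroup G}.

(* Main.v *)
Require Import Defs.
From HB Require Import structures.
From mathcomp Require Import all_boot all_order finmap interval.
From mathcomp Require Import all_classical topology.
Set Implicit Arguments.
Unset Strict Implicit.
Unset Printing Implicit Defensive.
Import Order.TTheory.
Local Open Scope classical_set_scope.
Local Open Scope quotient_scope.

(** Tychonoff-style compactness (an ultrafilter on the finite subsets of BF(A))
    reduces the theorem to finding, for a finite set E of reduced words, values
    F x in G with F x F y F z = 1 whenever x y z = 1 in E, and F = f on H.

    If x y z = 1, the concatenation of the three reduced words has a complete
    noncrossing pairing, and no pair lies inside one word; so it glues, in an
    order-reversing and letter-inverting way, a final segment of each word to
    an initial segment of the next one.  Transporting the cuts at the ends of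
    these segments along the gluings gives the "real" cuts.  Counting the
    letters of an orbit modulo 2 attaches to each real cut a vector in the span
    of finitely many vectors, while two letters of the same orbit are always
    separated by a real cut, because the words are reduced and each letter
    occurs finitely often.  Hence there is a finite gluing-invariant set of
    letters, the marks, such that there is a mark between any two distinct real
    cuts.

    F x is then a product over the marks of the word x: a mark contributes the
    value of f on it, and a gap between two consecutive marks contributes its
    value under f, or an arbitrary one outside H, unless a real cut splits the
    gap as l r.  In this case it contributes phi(l) phi(r^-1)^-1, where
    phi : BF(A) -> G satisfies phi(h x) = f(h) phi(x) for h in H; this is f(l r)
    as soon as l r belongs to H, even if l does not.  Tameness is used to see
    that all gaps of a word of H belong to H. *)

(** * Pairings and reduced words *)

Section Words.
Variable A : Type.
Implicit Types u v w : word A.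

(** Pointwise form of a cancellation: the equalities between intervals become stability of each
    interval under [star]. [T] may be empty here, so that the empty word has a complete pairing. *)
Definition pairing w (T : set (wdom w)) (star : wdom w -> wdom w) : Prop :=
  forall t, T t -> [/\ T (star t), star (star t) = t,
    wlab w (star t) = linv (wlab w t) &
    forall x, (t <= x <= star t)%O -> T x /\ (t <= star x <= star t)%O].

Lemma cancellationP w (T : set (wdom w)) star :
  cancellation T star <-> T !=set0 /\ pairing T star.
Proof.
split=> -[T0 cT]; split=> // t Tt.
  have [[Tst sst] E1 E2 lab] := cT t Tt; split=> // x tx.
  have : `[t, star t]%classic x by rewrite in_witv.
  rewrite E1 => -[Tx itx].
  have : (star @` (T `&` `[t, star t])) (star x) by exists x.
  by rewrite -E2 => -[_]; rewrite in_witv.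
have [Tst sst lab h] := cT t Tt; split=> //.
  apply/seteqP; split => [x itx|x []//]; split => //.
  by move: itx; rewrite in_witv => /h[].
apply/seteqP; split => [x [Tx]|y [x [Tx]]]; rewrite in_witv.
  move=> tx; have [Tsx ssx _ _] := cT x Tx; exists (star x) => //.
  by split => //; rewrite in_witv; apply: (h x tx).2.
by move=> tx <-; have [Tsx _ _ _] := cT x Tx; split=> //; rewrite in_witv;
  apply: (h x tx).2.
Qed.

Lemma linv_neq (l : letter A) : linv l <> l.
Proof. by case: l => a [] []. Qed.

Lemma pairing_neq w (T : set (wdom w)) star t :
  pairing T star -> T t -> star t <> t.
Proof. by move=> pT /pT[_ _ + _] e; rewrite e => /esym/linv_neq. Qed.

(** The tool for contradicting reducedness: along an order embedding [f], a pairing of [w] pulls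
    back to a cancellation of [u] on any nonempty set that is closed under partners and convex
    between them. *)
Lemma pairing_not_reduced u w (f : wdom u -> wdom w) (T' : set (wdom u))
    (T : set (wdom w)) star :
  {mono f : x y / (x <= y)%O} -> (forall x, wlab w (f x) = wlab u x) ->
  pairing T star -> T' !=set0 ->
  (forall x, T' x -> T (f x) /\ exists2 y, T' y & star (f x) = f y) ->
  (forall x y z, T' x -> T' y -> star (f x) = f y -> (x <= z <= y)%O -> T' z) ->
  ~ reduced u.
Proof.
move=> fm fl pT T'0 T'P T'c; apply; exists T'.
have finj : injective f.
  by move=> x y e; apply/le_anti; rewrite -!fm e lexx.
have /choice[star' sP] : forall x, exists y, T' x -> T' y /\ star (f x) = f y.
  move=> x; have [T'x|nT'x] := pselect (T' x); last by exists x.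
  by have [_ [y T'y e]] := T'P x T'x; exists y.
exists star'; apply/cancellationP; split => // t T't.
have [Tft _] := T'P t T't; have [T's se] := sP t T't.
have [_ ss lab h] := pT _ Tft; split => //.
- by apply: finj; have [_ <-] := sP _ T's; rewrite -se.
- by rewrite -fl -se lab fl.
- move=> x txs; have T'x : T' x by exact: T'c T't T's se txs.
  split=> //; have [_ e] := sP x T'x.
  by rewrite -!fm -se -e; apply: (h (f x) _).2; rewrite se !fm.
Qed.

Lemma wiso_surj u v (f : wdom u -> wdom v) :
  {homo f : x y / (x < y)%O} -> (forall y, exists x, f x = y) ->
  (forall x, wlab u x = wlab v (f x)) -> wequiv u v.
Proof.
move=> fm fs fl; apply: wequiv_iso; exists f.
have fle := le_mono fm; split=> //.
have /choice[h hP] := fs; exists h => // x.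
by apply/le_anti; rewrite -!fle hP lexx.
Qed.

(** Two successive cancellations merge into one. If a letter [x] of [T] lies between two partners of
    [T'], so does [star x]: otherwise an end of the [T']-pair would lie between [x] and [star x],
    hence in [T]. *)
Lemma pairing_union w (T : set (wdom w)) star (T' : set (wdom (wrestr (~` T)))) star' :
  pairing T star -> pairing T' star' ->
  exists star'', pairing (T `|` val @` T') star'' /\ (forall t, T t -> star'' t = star t).
Proof.
move=> pT pT'.
have valP' (x : wdom (wrestr (~` T))) : ~ T (val x) := set_mem (valP x).
pose s x := if pselect (T x) is left _ then star x else
  if pselect (exists2 y, T' y & val y = x) is left h then val (star' (projT1 (cid2 h))) else x.
have sT x : T x -> s x = star x by rewrite /s; case: pselect.
have sT' y : T' y -> s (val y) = val (star' y).
  move=> T'y; rewrite /s; case: pselect => [/valP'//|_].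
  case: pselect => [h|[]]; last by exists y.
  by case: (cid2 h) => z /= T'z /val_inj ->.
exists s; split => // t [Tt|[y T'y <-]].
  have [Tst sst lab h] := pT t Tt; rewrite sT //; split => //; first by left.
    by rewrite sT.
  by move=> x /h[Tx tx]; rewrite sT //; split => //; left.
have [Tst sst lab h] := pT' y T'y; rewrite sT' //; split => //.
- by right; exists (star' y).
- by rewrite sT' // sst.
- move=> x yx; have [Tx|nTx] := pselect (T x).
    split; first by left.
    have [Tsx ssx _ hx] := pT x Tx; rewrite sT //.
    apply/andP; split; rewrite leNgt; apply/negP => lt.
      have [_ _ _ hsx] := pT _ Tsx.
      have : (star x <= val y <= star (star x))%O.
        by rewrite ssx (ltW lt); case/andP: yx.
      by move=> /hsx[/valP'].
    have : (x <= val (star' y) <= star x)%O.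
      by rewrite (ltW lt) andbT; case/andP: yx.
    by move=> /hx[/valP'].
  have xT : x \in ~` T by apply/mem_set.
  have [T'x xs] := h (exist _ x xT) yx.
  split; first by right; exists (exist _ x xT).
  by have := sT' _ T'x => /= ->.
Qed.

(** Zorn's lemma on nonempty pairings ordered by extension. Chains are bounded by their unions, and
    what a maximal pairing leaves is reduced, because a further cancellation could be merged with
    it. *)
Lemma exists_reduced w : exists2 v, reduced v & wequiv w v.
Proof.
have [rw|/contrapT[T0 [s0 /cancellationP[T0n0 p0]]]] := pselect (reduced w).
  by exists w => //; exact: wequiv_refl.
pose D := {p : set (wdom w) * (wdom w -> wdom w) |
  p.1 !=set0 /\ pairing p.1 p.2}.
pose R (p q : D) := `[< (sval p).1 `<=` (sval q).1 /\
  forall t, (sval p).1 t -> (sval q).2 t = (sval p).2 t >].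
have Rt q p r : R p q -> R q r -> R p r.
  move=> /asboolP[pq pq'] /asboolP[qr qr']; apply/asboolP; split.
    exact: subset_trans pq qr.
  by move=> t pt; rewrite qr' ?pq' //; exact: pq.
have [||C totC|[[T s] /= [T0' pT]] maxT] := @ZL_preorder D
    (exist _ (T0, s0) (conj T0n0 p0)) R.
- by move=> p; apply/asboolP; split.
- by move=> q p r; exact: Rt.
- have [[p0' Cp0]|C0] := pselect (C !=set0); last first.
    exists (exist _ (T0, s0) (conj T0n0 p0)) => p Cp.
    by case: C0; exists p.
  pose T := \bigcup_(p in C) (sval p).1.
  have /choice[s sP] : forall t, exists y, forall p, C p -> (sval p).1 t -> y = (sval p).2 t.
    move=> t; have [[p Cp pt]|nT] := pselect (T t); last first.
      by exists t => p Cp pt; case: nT; exists p.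
    exists ((sval p).2 t) => q Cq qt.
    have [/asboolP[_ ->]|/asboolP[_ ->]]// := totC _ _ Cp Cq.
  have pT : pairing T s.
    move=> t [p Cp pt]; have [pst sst lab h] := (svalP p).2 t pt.
    rewrite (sP t p) //; split => //; first by exists p.
      by rewrite (sP _ p).
    move=> x /h[px xs]; rewrite (sP x p) //; split => //; by exists p.
  have T0' : T !=set0 by have [t pt] := (svalP p0').1; exists t; exists p0'.
  exists (exist _ (T, s) (conj T0' pT)) => p Cp; apply/asboolP; split => /=.
    by move=> t pt; exists p.
  by move=> t pt; exact: sP.
- have cT : cancellation T s by apply/cancellationP.
  exists (wrestr (~` T)); last exact: wequiv_cancel cT.
  move=> [T' [s' /cancellationP[[y T'y] pT']]].
  have [s'' [pU sU]] := pairing_union pT pT'.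
  have U0 : (T `|` val @` T') !=set0 by exists (val y); right; exists y.
  have /asboolP[/= UT _] : R (exist _ (T `|` val @` T', s'') (conj U0 pU))
       (exist _ (T, s) (conj T0' pT)).
    by apply: maxT; apply/asboolP; split => //= t Tt; left.
  by apply: (set_mem (valP y)); apply: UT; right; exists y.
Qed.
End Words.

(** * Classes of restricted words, and initial segments of words in a tame subgroup *)

Section Classes.
Variable A : Type.
Implicit Types u v w : word A.
Local Open Scope group_scope.

Definition cls w (L : set (wdom w)) : BF A := \pi_(BF A) (wrestr L).

Lemma BF_mulE u v : \pi_(BF A) u * \pi_(BF A) v = \pi_(BF A) (wcat u v).
Proof. exact: BFmul_pi. Qed.

Lemma BF_invE u : (\pi_(BF A) u)^-1 = \pi_(BF A) (winv u).
Proof. exact: BFinv_pi. Qed.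

Lemma clsT w : cls [set: wdom w] = \pi_(BF A) w.
Proof.
apply/BF_eqP; apply: (@wiso_surj _ (wrestr setT) w (fun x => val x)) => // y.
by exists (exist _ y (mem_set I)).
Qed.

Lemma cls0 w : cls (@set0 (wdom w)) = 1.
Proof.
apply/BF_eqP.
have no (x : wdom (wrestr (@set0 (wdom w)))) : False := set_mem (valP x).
by apply: (@wiso_surj _ _ (wempty A) (fun x => match no x with end)) => // x; case: (no x).
Qed.

Lemma wrestr_lt w (D : set (wdom w)) (x y : wdom (wrestr D)) :
  (x < y)%O = (val x < val y)%O.
Proof. by rewrite !ltNge. Qed.

Lemma cls_split w (L M : set (wdom w)) :
  (forall x y, L y -> (x <= y)%O -> L x) -> L `<=` M ->
  cls M = cls L * cls (M `\` L).
Proof.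
move=> Ld LM; rewrite BF_mulE; apply/esym/BF_eqP.
have fL (x : wdom (wrestr L)) : val x \in M by apply/mem_set/LM/set_mem/valP.
have fD (x : wdom (wrestr (M `\` L))) : val x \in M.
  by have [Mx _] := set_mem (valP x); apply/mem_set.
pose f (x : wdom (wcat (wrestr L) (wrestr (M `\` L)))) : wdom (wrestr M) :=
  match x with inl x => exist _ (val x) (fL x) | inr x => exist _ (val x) (fD x) end.
apply: (@wiso_surj _ _ _ f).
- move=> x y; rewrite wrestr_lt !ltNge; case: x y => x [] y //= _.
  apply/negP => yx; have [_ nLy] := set_mem (valP y); apply: nLy.
  apply: Ld yx; exact: (set_mem (valP x)).
- move=> [y My]; have [Ly|nLy] := pselect (L y).
    by exists (inl (exist _ y (mem_set Ly))); apply: (@val_inj _ _ {s | s \in M}).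
  have Dy : (M `\` L) y by split; [exact: set_mem My|].
  by exists (inr (exist _ y (mem_set Dy))); apply: (@val_inj _ _ {s | s \in M}).
- by case.
Qed.

(** Meant for gluings, which reverse the order and invert the letters. *)
Lemma cls_anti u v (X : set (wdom u)) (f : wdom u -> wdom v) :
  (forall x y, X x -> X y -> (x < y)%O -> (f y < f x)%O) ->
  (forall x, X x -> wlab v (f x) = linv (wlab u x)) ->
  cls (f @` X) = (cls X)^-1.
Proof.
move=> fm fl; rewrite BF_invE; apply/esym/BF_eqP.
have fX (x : wdom (wrestr X)) : f (val x) \in f @` X.
  by apply/mem_set; exists (val x) => //; exact: (set_mem (valP x)).
pose h (x : wdom (winv (wrestr X))) : wdom (wrestr (f @` X)) := exist _ (f (val x)) (fX x).
apply: (@wiso_surj _ _ _ h).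
- move=> x y; rewrite wrestr_lt ltNge => xy; apply: fm.
  + exact: (set_mem (valP y)).
  + exact: (set_mem (valP x)).
  + by rewrite ltNge.
- move=> [y /= Xy]; have [x Xx xy] := set_mem Xy.
  by exists (exist _ x (mem_set Xx)); apply: (@val_inj _ _ {s | s \in f @` X}).
- by move=> x /=; rewrite fl //; exact: (set_mem (valP x)).
Qed.

Section Prefix.
Variable S : {pred BF A}.
Hypothesis S_mul : forall x y, x \in S -> y \in S -> x * y \in S.
Hypothesis S_inv : forall x, x \in S -> x^-1 \in S.
Hypothesis tameS : tame S.

(** If the added letter had a partner [t] in [w], the letters of [w] before [t] would be paired
    among themselves. There are such letters, as [w] has no first one, so [w] would admit a
    cancellation. *)
Lemma reduced_cons l w : (forall x y : wdom l, x = y) -> reduced w ->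
  (forall z : wdom w, exists x, (x < z)%O) -> reduced (wcat l w).
Proof.
move=> l1 rw nomin [T [star /cancellationP[[t0 Tt0] pT]]].
have inl_inr a : T (inl a) -> exists t, star (inl a) = inr t.
  move=> Ta; have := pairing_neq pT Ta; case: (star _) => [b|t _]; last by exists t.
  by rewrite (l1 a b).
have inrm : {mono (@inr _ _ : wdom w -> wdom (wcat l w)) : x y / (x <= y)%O} by [].
have [[a Ta]|nT] := pselect (exists a, T (inl a)).
  have [t st] := inl_inr a Ta.
  have [Tst sst _ h] := pT _ Ta; rewrite st in sst.
  have xt x : (x < t)%O -> T (inr x) /\ exists2 y, (y < t)%O & star (inr x) = inr y.
    move=> xlt; have [|Tx itx] := h (inr x); first by rewrite st; apply: ltW.
    split=> //; have [_ ssx _ _] := pT _ Tx.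
    rewrite st in itx; case: (star (inr x)) itx ssx => [b _|y ity ssy].
      by rewrite (l1 b a) st => -[e]; rewrite e ltxx in xlt.
    exists y => //; rewrite lt_neqAle; apply/andP; split => //.
    by apply/eqP => e; move: ssy; rewrite e sst.
  apply: (pairing_not_reduced (T' := [set x | (x < t)%O]) inrm _ pT _ xt) rw => //.
    by have [x xt0] := nomin t; exists x.
  by move=> x y z _ yt _ /andP[_ zy]; exact: le_lt_trans zy yt.
have Tinr t : T t -> exists2 x, t = inr x & T (inr x).
  by case: t => [b Tb|x Tx]; [case: nT; exists b|exists x].
apply: (pairing_not_reduced (T' := [set x | T (inr x)]) inrm _ pT) rw => //.
- by have [x _ Tx] := Tinr _ Tt0; exists x.
- move=> x Tx; split => //; have [Tsx _ _ _] := pT _ Tx.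
  by have [y -> Ty] := Tinr _ Tsx; exists y.
- move=> x y z /= Tx Ty sx xzy; have [_ _ _ h] := pT _ Tx.
  by apply: (h (inr z) _).1; rewrite sx.
Qed.

(** Tameness speaks only of closed intervals, so an initial segment needs a first letter. When [w]
    has none, a copy of the letter at [z], which lies in [S], is put in front of [w] and divided out
    afterwards. *)
Lemma cls_prefix_tame w : reduced w -> \pi_(BF A) w \in S ->
  forall z, cls [set x : wdom w | (x <= z)%O] \in S.
Proof.
move=> rw Sw z.
have [[m mmin]|nomin] := pselect (exists m : wdom w, forall x, (m <= x)%O).
  have -> : [set x : wdom w | (x <= z)%O] = `[m, z]%classic.
    by rewrite predeqE => x; rewrite in_witv; have -> : wle w m x by exact: mmin.
  exact: tameS rw Sw m z.
have {}nomin x : exists y, (y < x :> wdom w)%O.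
  apply: contrapT => h; apply: nomin; exists x => y; rewrite leNgt.
  by apply/negP => yx; apply: h; exists y.
pose l := subword z z; have Sl : \pi_(BF A) l \in S by exact: tameS.
have zl (x : wdom l) : val x = z.
  by apply/le_anti; rewrite andbC; have := set_mem (valP x); rewrite in_witv.
have l1 (x y : wdom l) : x = y.
  by apply: (@val_inj _ _ {s | s \in `[z, z]%classic}); rewrite !zl.
have zz : z \in `[z, z]%classic by apply/mem_set; rewrite in_witv; apply/andP; split; exact: lexx.
pose a : wdom l := exist _ z zz; pose w' := wcat l w.
have Sw' : \pi_(BF A) w' \in S by rewrite -BF_mulE; exact: S_mul.
have := tameS (reduced_cons l1 rw nomin) Sw' (inl a) (inr z).
suff -> : \pi_(BF A) (@subword _ w' (inl a) (inr z)) =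
    \pi_(BF A) l * cls [set x : wdom w | (x <= z)%O].
  move=> Slz; rewrite -[cls _](mulKg (\pi_(BF A) l)).
  by apply: S_mul => //; exact: S_inv.
rewrite BF_mulE; apply/esym/BF_eqP.
pose D : set (wdom w') := `[(inl a : wdom w'), (inr z : wdom w')]%classic.
have fl b : (inl b : wdom w') \in D.
  by apply/mem_set; rewrite /D in_witv (l1 b a) andbT; exact: (lexx a).
have fr (x : wdom (wrestr [set x : wdom w | (x <= z)%O])) :
    (inr (val x) : wdom w') \in D.
  by apply/mem_set; rewrite /D in_witv; exact: (set_mem (valP x)).
pose f (x : wdom (wcat l (wrestr [set x : wdom w | (x <= z)%O]))) : wdom (wrestr D) :=
  match x with inl b => exist _ (inl b) (fl b) | inr x => exist _ (inr (val x)) (fr x) end.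
apply: (@wiso_surj _ _ _ f).
- by move=> x y; rewrite wrestr_lt !ltNge; case: x y => x [] y.
- case=> -[b|x] h.
    by exists (inl b); apply: (@val_inj _ _ {s | s \in D}).
  have xz : (x <= z)%O by have := set_mem h; rewrite /D in_witv.
  by exists (inr (exist _ x (mem_set xz))); apply: (@val_inj _ _ {s | s \in D}).
- by case.
Qed.
End Prefix.
End Classes.

(** * Words equivalent to the empty word *)

Section FreeReduction.
Variable A : eqType.
Implicit Types (a b : letter A) (r : seq (letter A)).

(** Left multiplication by a letter in the free group, on freely reduced lists; [red] below computes
    the freely reduced form of a list. *)
Definition act a r : seq (letter A) :=
  if r is b :: r' then if b == linv a then r' else a :: r else [:: a].

Definition freely_reduced r := sorted (fun a b => b != linv a) r.

Lemma act_reduced a r : freely_reduced r -> freely_reduced (act a r).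
Proof.
case: r => //= b r; case: ifP => [_|ba] br.
  exact: path_sorted br.
by rewrite /freely_reduced /= ba.
Qed.

Lemma actK a r : freely_reduced r -> act (linv a) (act a r) = r.
Proof.
case: r => [_|b r] /=; first by rewrite linvK eqxx.
case: ifP => [/eqP-> {b}|_ _]; last by rewrite /= linvK eqxx.
by case: r => [//|c r] /= /andP[+ _]; rewrite linvK => /negbTE->.
Qed.

Definition red (s : seq (letter A)) := foldr act [::] s.

Lemma foldr_act_reduced r s : freely_reduced r -> freely_reduced (foldr act r s).
Proof. by move=> rr; elim: s => //= a s; exact: act_reduced. Qed.

Inductive dyck (P : Type) (lab : P -> letter A) : seq P -> Prop :=
| dyck_nil : dyck lab [::]
| dyck_cons x u y v : lab y = linv (lab x) -> dyck lab u -> dyck lab v ->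
    dyck lab (x :: u ++ y :: v).

(** The two clauses are proved together: when the letter of [x] cancels the first surviving letter
    [y] of the tail, the part between them is a Dyck word by the second clause, and both clauses are
    applied again to what follows [y]. *)
Lemma red_dyck_split (P : Type) (lab : P -> letter A) (s : seq P) :
  (red (map lab s) = [::] -> dyck lab s) /\
  (forall a r, red (map lab s) = a :: r -> exists d y t,
     [/\ s = d ++ y :: t, dyck lab d, lab y = a & red (map lab t) = r]).
Proof.
have [n] := ubnP (size s); elim: n s => // n IH [_|x s]; first by split => // _; left.
rewrite ltnS [size _]/= => sn; have [IHs0 IHs1] := IH s sn.
rewrite /red /= -/(red (map lab s)).
case E: (red (map lab s)) IHs0 IHs1 => [|b r0] /=.
  move=> _ _; split=> // a r [<- <-]; exists [::], x, s; split => //; by left.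
move=> _ /(_ b r0 erefl)[d [y [t [sE dd yb tr]]]].
have [bx|_] := eqVneq b (linv (lab x)); last first.
  by split=> // a r [<- <-]; exists [::], x, s; split => //; left.
have yx : lab y = linv (lab x) by rewrite yb.
have tn : size t < n.
  by apply: leq_ltn_trans sn; rewrite sE size_cat /= addnS leqW // leq_addl.
have [IHt0 IHt1] := IH t tn.
split=> [r00|a r r0E].
  by rewrite sE; apply: dyck_cons => //; apply: IHt0; rewrite tr.
have [|d' [y' [t' [tE dd' y'a t'r]]]] := IHt1 a r; first by rewrite tr.
exists (x :: d ++ y :: d'), y', t'; split => //; last exact: dyck_cons.
by rewrite sE tE /= -catA.
Qed.
End FreeReduction.

(** * Finite truncations of words and passage to the limit *)

Section Levels.
Variable A : countType.
Implicit Types w : word A.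

(** Truncation to the symbols of index below [n]; it keeps finitely many letters of a word. *)
Definition level (n : nat) w : pred (wdom w) := fun x => choice.pickle (wlab w x).1 < n.

Lemma level_finite n w : finite_set [set x : wdom w | level n x].
Proof.
have fA : finite_set [set a : A | choice.pickle a < n].
  apply: (@finite_preimage _ _ `I_n choice.pickle); last exact: finite_II.
  by move=> x y _ _; exact: (pcan_inj choice.pickleK).
apply: (@sub_finite_set _ _ (\bigcup_(a in [set a : A | choice.pickle a < n])
   (wlab w @^-1` [set (a, false)] `|` wlab w @^-1` [set (a, true)]))).
  move=> x lx; exists (wlab w x).1 => //=.
  by case: (wlab w x) => a []; [right|left].
apply: bigcup_finite => // a _.
by rewrite finite_setU; split; exact: wlab_finite.
Qed.

Definition level_list n w : seq (wdom w) :=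
  sort <=%O (enum_fset (fset_set [set x : wdom w | level n x])).

Lemma mem_level_list n w x : (x \in level_list n w) = level n x.
Proof.
rewrite mem_sort in_fset_set; last exact: level_finite.
by apply/idP/idP => [/set_mem|lx]; last exact/mem_set.
Qed.

Lemma level_list_sorted n w : sorted <%O (level_list n w).
Proof. by rewrite sort_lt_sorted fset_uniq. Qed.

Lemma level_listE n w (s : seq (wdom w)) :
  sorted <%O s -> (forall x, (x \in s) = level n x) -> s = level_list n w.
Proof.
move=> ss sE; apply: lt_sorted_eq => //; first exact: level_list_sorted.
by move=> x; rewrite sE mem_level_list.
Qed.

Definition list_pairing w (s : seq (wdom w)) star := forall t, t \in s ->
  [/\ star t \in s, star (star t) = t, wlab w (star t) = linv (wlab w t) &
   forall x, x \in s -> (t <= x <= star t)%O -> (t <= star x <= star t)%O].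

(** The first letter and its match [y] become partners, and the pairings of [u] and [v] are put
    together by cases; strict sortedness keeps the cases disjoint. *)
Lemma dyck_list_pairing w (s : seq (wdom w)) :
  dyck (wlab w) s -> pairwise <%O s -> exists star, list_pairing s star.
Proof.
elim=> {s} [_|x u y v yx _ IHu _ IHv].
  by exists id.
rewrite pairwise_cons pairwise_cat pairwise_cons all_cat /= => /and3P[xl uv].
case/andP: xl => /allP xu /andP[xy /allP xv] /andP[pu /andP[/allP yv pv]].
have {uv}uv := allrelP uv.
have [su su'] := IHu pu; have [sv sv'] := IHv pv.
have uy a : a \in u -> (a < y)%O by move=> au; apply: uv => //; exact: mem_head.
pose star t := if t == x then y else if t == y then x else
  if t \in u then su t else sv t.
have sx : star x = y by rewrite /star eqxx.
have sy : star y = x by rewrite /star eqxx (gt_eqF xy).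
have sU t : t \in u -> star t = su t.
  by move=> tu; rewrite /star (gt_eqF (xu t tu)) (lt_eqF (uy t tu)) tu.
have sV t : t \in v -> star t = sv t.
  move=> tv; rewrite /star (gt_eqF (xv t tv)) (gt_eqF (yv t tv)).
  by case: ifP => // /uy; rewrite ltNge (ltW (yv t tv)).
have memE t : (t \in x :: u ++ y :: v) = [|| t == x, t == y, t \in u | t \in v].
  by rewrite inE mem_cat inE; congr (_ || _); rewrite orbCA.
have U0 t : t \in u -> [/\ star t \in u, star (star t) = t & wlab w (star t) = linv (wlab w t)].
  by move=> tu; have [h1 h2 h3 _] := su' t tu; rewrite sU // sU.
have V0 t : t \in v -> [/\ star t \in v, star (star t) = t & wlab w (star t) = linv (wlab w t)].
  by move=> tv; have [h1 h2 h3 _] := sv' t tv; rewrite sV // sV.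
exists star => t; rewrite memE => /or4P[/eqP->|/eqP->|tu|tv].
- rewrite sx; split => //; first by rewrite memE eqxx orbT.
  move=> a; rewrite memE => /or4P[/eqP->|/eqP->|au|av] /andP[xa ay].
  + by rewrite sx lexx (ltW xy).
  + by rewrite sy lexx (ltW xy).
  + by have [h _ _] := U0 a au; rewrite (ltW (xu _ h)) (ltW (uy _ h)).
  + by move: ay; rewrite leNgt yv.
- rewrite sy; split => //; first by rewrite memE eqxx.
    by rewrite yx linvK.
  by move=> a _ /andP[ya ax]; have := le_trans ya ax; rewrite leNgt xy.
- have [h1 h2 h3] := U0 t tu; split => //; first by rewrite memE h1 !orbT.
  move=> a; rewrite memE => /or4P[/eqP->|/eqP->|au|av] /andP[ta ast].
  + by move: ta; rewrite leNgt xu.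
  + by move: ast; rewrite leNgt uy.
  + have [_ _ _ h] := su' t tu; rewrite (sU a) // (sU t) //; apply: h => //.
    by rewrite ta -sU.
  + by move: ast; rewrite leNgt (lt_trans (uy _ h1)) // yv.
- have [h1 h2 h3] := V0 t tv; split => //; first by rewrite memE h1 !orbT.
  move=> a; rewrite memE => /or4P[/eqP->|/eqP->|au|av] /andP[ta ast].
  + by move: ta; rewrite leNgt xv.
  + by move: ta; rewrite leNgt yv.
  + by move: ta; rewrite leNgt (lt_trans (uy _ au)) // yv.
  + have [_ _ _ h] := sv' t tv; rewrite (sV a) // (sV t) //; apply: h => //.
    by rewrite ta -sV.
Qed.

(** Deleting the paired letters does not change the free reduction of a finite list closed under
    [star]. The accumulator [r] is arbitrary so that the induction also applies to the stretch
    between two partners. *)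
Lemma red_pairing w (T : set (wdom w)) star (s : seq (wdom w)) r :
  pairing T star -> pairwise <%O s -> (forall t, t \in s -> T t -> star t \in s) ->
  freely_reduced r ->
  foldr (@act A) r (map (wlab w) s) =
  foldr (@act A) r (map (wlab w) [seq x <- s | `[< ~ T x >]]).
Proof.
move=> pT; have [n] := ubnP (size s); elim: n s r => // n IH [//|x s] r.
rewrite ltnS [size _]/= pairwise_cons => sn /andP[/allP xs ps] sc rr.
have [Tx|nTx] := pselect (T x); last first.
  rewrite [seq.filter _ _]/= asboolT //=; congr act; apply: IH => // t ts Tt.
  have := sc t _ Tt; rewrite !inE ts orbT => /(_ isT)/orP[/eqP e|//].
  by have [] := pT t Tt; rewrite e.
have [Tsx ssx lx hx] := pT x Tx.
have sxs : star x \in s.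
  have := sc x (mem_head _ _) Tx; rewrite inE => /orP[/eqP|//].
  by move/(pairing_neq pT Tx).
rewrite [seq.filter _ _]/= asboolF; last by move=> /(_ Tx).
case/splitPr: sxs sn ps xs sc => u v sn.
rewrite pairwise_cat pairwise_cons => /and3P[/allrelP uv pu /andP[/allP yv pv]] xs sc.
have uy a : a \in u -> (a < star x)%O by move=> au; apply: uv => //; exact: mem_head.
have Tu a : a \in u -> (x <= a <= star x)%O.
  by move=> au; rewrite (ltW (uy a au)) ltW // xs // mem_cat au.
have fu : [seq z <- u | `[< ~ T z >]] = [::].
  apply/eqP; rewrite -(negbK (_ == _)) -has_filter -all_predC; apply/allP => a au /=.
  by apply/negP => /asboolP; apply; exact: (hx a (Tu a au)).1.
have su : size u < n.
  by apply: leq_ltn_trans sn; rewrite size_cat leq_addr.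
have sv : size v < n.
  by apply: leq_ltn_trans sn; rewrite size_cat /= addnS leqW // leq_addl.
rewrite filter_cat fu /= asboolF; last by move=> /(_ Tsx).
(* All letters of [u] are paired inside [u], so [u] acts trivially, and the letters of [x] and
   [star x] then cancel. *)
rewrite map_cat foldr_cat /= IH //; first last.
- by apply: act_reduced; exact: foldr_act_reduced.
- move=> t tu Tt; have [_ sst _ _] := pT t Tt.
  have [_ tin] := hx t (Tu t tu).
  have := sc t _ Tt; rewrite !(inE, mem_cat) tu orbT => /(_ isT)/or4P[/eqP e|//|/eqP e|tv].
  + by move: (uy t tu); rewrite -sst e ltxx.
  + have := xs t; rewrite mem_cat tu => /(_ isT).
    by rewrite -sst e ssx ltxx.
  + by move: tin; rewrite [(_ <= star x)%O]leNgt yv // andbF.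
rewrite fu /= lx -{1}[wlab w x]linvK actK; last exact: foldr_act_reduced.
apply: IH => // t tv Tt; have [_ sst _ _] := pT t Tt.
have nin : ~ (x <= star t <= star x)%O.
  by move=> /hx[_]; rewrite sst => /andP[_]; rewrite leNgt yv.
have := sc t _ Tt; rewrite !(inE, mem_cat) tv !orbT => /(_ isT)/or4P[/eqP e|su'|/eqP e|//].
- by case: nin; rewrite e lexx ltW // xs // mem_cat mem_head orbT.
- by case: nin; exact: Tu.
- by case: nin; rewrite e lexx andbT ltW // xs // mem_cat mem_head orbT.
Qed.

Lemma red_wequiv n w1 w2 : wequiv w1 w2 ->
  red (map (wlab w1) (level_list n w1)) = red (map (wlab w2) (level_list n w2)).
Proof.
elim=> {w1 w2} [u v [phi [[psi phiK psiK] mono lab]]|w T star /cancellationP[_ pT]|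
  u v _ -> //|u v w _ -> _ -> //].
- rewrite -(@level_listE n v (map phi (level_list n u))).
  + by rewrite -map_comp; congr red; apply: eq_map.
  + apply: homo_sorted (level_list_sorted n u) => x y.
    by rewrite !ltNge mono.
  + move=> y; rewrite -[y]psiK mem_map; last exact: can_inj phiK.
    by rewrite mem_level_list /level lab.
- rewrite /red (@red_pairing w T star (level_list n w)) //.
  + congr foldr.
    rewrite (_ : [seq x <- _ | _] = map (fun x : wdom (wrestr (~` T)) => val x)
       (level_list n (wrestr (~` T)))).
      by rewrite -map_comp.
    apply: lt_sorted_eq.
    * apply: sorted_filter; [exact: lt_trans|exact: level_list_sorted].
    * by apply: homo_sorted (level_list_sorted n _) => x y; rewrite wrestr_lt.
    * move=> x; rewrite mem_filter mem_level_list; apply/andP/mapP.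
        move=> [/asboolP nTx lx]; exists (exist _ x (mem_set nTx)) => //.
        by rewrite mem_level_list.
      move=> [y ly ->]; rewrite mem_level_list in ly; split => //.
      by apply/asboolP; exact: (set_mem (valP y)).
  + by rewrite -sorted_pairwise; [exact: level_list_sorted|exact: lt_trans].
  + move=> t; rewrite !mem_level_list /level => lt Tt.
    by have [_ _ -> _] := pT t Tt.
Qed.

(** Every truncation reduces to the empty list and so has a complete pairing. These pairings have a
    limit along an ultrafilter on the levels, since a letter [t] has only finitely many possible
    partners, namely those labelled by the inverse of its label. *)
Lemma wequiv_empty_pairing w : wequiv w (wempty A) ->
  exists star, pairing [set: wdom w] star.
Proof.
move=> we.
have /choice[sn snP] : forall n, exists star, list_pairing (level_list n w) star.
  move=> n; apply: dyck_list_pairing.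
    apply: (red_dyck_split (wlab w) _).1; rewrite (red_wequiv n we).
    by case: (level_list _ _) => [//|[]].
  by rewrite -sorted_pairwise; [exact: level_list_sorted|exact: lt_trans].
have [U [UU sU]] := @ultraFilterLemma nat \oo _.
have Ulev (t : wdom w) : U [set n | level n t].
  by apply: sU; exists (choice.pickle (wlab w t).1).+1.
have /choice[star starP] : forall t : wdom w, exists u : wdom w, U [set n | sn n t = u].
  move=> t; apply: contrapT => nU.
  have fD : finite_set (wlab w @^-1` [set linv (wlab w t)]) by exact: wlab_finite.
  have : U (\bigcap_(u in [set` fset_set (wlab w @^-1` [set linv (wlab w t)])])
     [set n | sn n t <> u]).
    apply: filter_bigI => u _.
    have [|//] := in_ultra_setVsetC [set n | sn n t = u] UU.
    by move=> Uu; case: nU; exists u.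
  move=> /(filterI (Ulev t))/filter_ex[n [lt]] /(_ (sn n t)); apply => //=.
  rewrite in_fset_set //; apply/mem_set => /=.
  by have [|_ _ -> _] := snP n t; first by rewrite mem_level_list.
(* Each requirement on a pairing involves finitely many letters, so it can be read off at a single
   level. *)
have key (t x : wdom w) : exists n, [/\ level n t, level n x, sn n t = star t,
    sn n (star t) = star (star t) & sn n x = star x].
  have [n [h1 [h2 [h3 [h4 h5]]]]] := filter_ex (filterI (Ulev t)
    (filterI (Ulev x) (filterI (starP t) (filterI (starP (star t)) (starP x))))).
  by exists n.
exists star => t _.
have [n [lt _ st sst _]] := key t t.
have [|_ h2 h3 _] := snP n t; first by rewrite mem_level_list.
rewrite -sst -st; split => // x tx.
have [m [lt' lx st' _ sx]] := key t x.
have [|_ _ _ h4] := snP m t; first by rewrite mem_level_list.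
split=> //; rewrite -sx st -st'; apply: h4; first by rewrite mem_level_list.
by rewrite st' -st.
Qed.
End Levels.

(** * Gluings, real cuts and orbits *)

Section Gluing.
Variables (A : Type) (I : Type) (W : I -> word A).

(** [gmap] is a total function whose values outside [gdom] are irrelevant. [gdom_up] makes the
    domain a final segment, and [gcod_down] makes the image an initial one. *)
Record gluing := Gluing {
  gsrc : I;
  gdst : I;
  gdom : set (wdom (W gsrc));
  gmap : wdom (W gsrc) -> wdom (W gdst);
  gdom_up : forall p q, (p <= q)%O -> gdom p -> gdom q;
  gcod_down : forall p q, gdom p -> (q <= gmap p)%O ->
    exists2 r, gdom r & gmap r = q;
  gmap_anti : forall p q, gdom p -> gdom q -> (p < q)%O -> (gmap q < gmap p)%O;
  gmap_lab : forall p, gdom p -> wlab (W gdst) (gmap p) = linv (wlab _ p) }.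

Lemma gmap_inj (h : gluing) p q :
  gdom p -> gdom q -> gmap p = gmap q :> wdom (W (gdst h)) -> p = q.
Proof.
move=> Up Uq e; case: (ltgtP p q) => // pq; have := gmap_anti _ _ pq.
  by rewrite e ltxx => /(_ Up Uq).
by rewrite e ltxx => /(_ Uq Up).
Qed.

Lemma gmap_anti_le (h : gluing) (p q : wdom (W (gsrc h))) :
  gdom p -> gdom q -> (gmap q <= gmap p)%O = (p <= q)%O.
Proof.
move=> Up Uq; case: (ltgtP p q) => pq.
- by apply: ltW; exact: gmap_anti.
- by apply/negbTE; rewrite -ltNge; exact: gmap_anti.
- by rewrite pq lexx.
Qed.

Variables (K : finType) (g : K -> gluing).

(* Identifying a lower set with the cut that it makes, these are the cuts
   obtained from the ends of the glued segments by transport along the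
   gluings. *)
Inductive real : forall i, set (wdom (W i)) -> Prop :=
| real0 i : @real i set0
| real_dom k : @real (gsrc (g k)) (~` @gdom (g k))
| real_fwd k L : @real (gsrc (g k)) L -> ~` @gdom (g k) `<=` L ->
    @real (gdst (g k)) (@gmap (g k) @` (@gdom (g k) `\` L))
| real_bwd k L : @real (gdst (g k)) L -> L `<=` @gmap (g k) @` @gdom (g k) ->
    @real (gsrc (g k)) [set p | gdom p -> ~ L (gmap p)].

Lemma real_down i (L : set (wdom (W i))) :
  real L -> forall p q, (q <= p)%O -> L p -> L q.
Proof.
elim=> {i L} [i|k|k L _ IH UL|k L _ IH LD] p q qp //.
- by move=> nUp Uq; apply: nUp; exact: gdom_up Uq.
- case=> r [Ur nLr] rp; subst p.
  have [r' Ur' r'q] := gcod_down Ur qp; exists r' => //; split => // Lr'.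
  apply: nLr; apply: IH Lr'.
  by rewrite -gmap_anti_le // r'q.
- move=> /= h Uq Lq; have Up := gdom_up qp Uq.
  by apply: (h Up); apply: IH Lq; rewrite gmap_anti_le.
Qed.

Lemma real_total i (L M : set (wdom (W i))) :
  real L -> real M -> L `<=` M \/ M `<=` L.
Proof.
move=> rL rM; have [|nLM] := pselect (L `<=` M); [by left|right].
move=> q Mq; apply: contrapT => nLq; apply: nLM => p Lp.
apply: real_down Mq => //.
case: (leP p q) => // /ltW qp; exfalso; apply: nLq.
exact: real_down qp Lp.
Qed.

(** The end of the source of a gluing is real because it is the empty cut of the target, pulled
    back. *)
Lemma realT k : @real (gsrc (g k)) setT.
Proof.
have -> : [set: wdom (W (gsrc (g k)))] =
    [set p | @gdom (g k) p -> ~ set0 (gmap p)].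
  by apply/seteqP; split => // p _ _ [].
by apply: real_bwd; [exact: real0|].
Qed.

Lemma real_cod k : @real (gdst (g k)) (@gmap (g k) @` @gdom (g k)).
Proof.
have -> : @gdom (g k) = @gdom (g k) `\` ~` @gdom (g k).
  by rewrite setDE setCK setIid.
by apply: real_fwd; first exact: real_dom.
Qed.

Definition blk i (p q : wdom (W i)) := forall L, real L -> (L p <-> L q).

Lemma blk_refl i (p : wdom (W i)) : blk p p. Proof. by []. Qed.
Lemma blk_sym i (p q : wdom (W i)) : blk p q -> blk q p.
Proof. by move=> h L rL; split=> /(h L rL). Qed.
Lemma blk_trans i (p q r : wdom (W i)) : blk p q -> blk q r -> blk p r.
Proof.
by move=> pq qr L rL; split=> [/(pq L rL)/(qr L rL)|/(qr L rL)/(pq L rL)].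
Qed.

Lemma blk_convex i (p q r : wdom (W i)) :
  blk p q -> (p <= r <= q)%O -> blk p r.
Proof.
move=> pq /andP[pr rq] L rL; split => [/(pq L rL)|]; exact: real_down.
Qed.

Lemma blk_dom k p q : @blk (gsrc (g k)) p q -> gdom p -> gdom q.
Proof.
move=> pq Up; apply: contrapT => nUq.
by have [_ /(_ nUq)] := pq _ (real_dom k).
Qed.

(** A real cut between the images either contains the whole image of the gluing, and then separates
    nothing there, or pulls back by [real_bwd] to a real cut between the letters. The next lemma is
    the converse, by [real_fwd]. *)
Lemma blk_gmap k p q : @gdom (g k) p -> blk p q -> blk (gmap p) (gmap q).
Proof.
move=> + pq.
wlog suff: p q pq / @gdom (g k) p -> forall L, real L -> L (gmap p) -> L (gmap q).
  move=> h Up L rL; split; first exact: h.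
  apply: h => //; [exact: blk_sym|exact: blk_dom pq Up].
move=> Up L rL Lp; have Uq := blk_dom pq Up.
have [LD|DL] := real_total rL (real_cod k); last by apply: DL; exists q.
apply: contrapT => nLq.
by have [_ /(_ (fun _ => nLq) Up)] := pq _ (real_bwd rL LD).
Qed.

Lemma blk_cod k p b : @gdom (g k) p -> blk (gmap p) b ->
  exists q, [/\ gdom q, gmap q = b & blk p q].
Proof.
move=> Up pb.
have /(pb _ (real_cod k))[q Uq qb] : (@gmap (g k) @` @gdom (g k)) (gmap p).
  by exists p.
subst b; exists q; split => //.
have {}Wlog p' q' : @gdom (g k) p' -> gdom q' -> blk (gmap p') (gmap q') ->
    forall L, real L -> L p' -> L q'.
  move=> {p q Up Uq pb} Up Uq pq L rL Lp.
  have [UL|LU] := real_total (real_dom k) rL; last by case: (LU _ Lp).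
  apply: contrapT => nLq.
  have [_] := pq _ (real_fwd rL UL).
  case; first by exists q'.
  by move=> r [Ur nLr] /(gmap_inj Ur Up) rp; apply: nLr; rewrite rp.
by move=> L rL; split; apply: Wlog => //; exact: blk_sym.
Qed.

Inductive orb i (p : wdom (W i)) : forall j, wdom (W j) -> Prop :=
| orb_refl : @orb i p i p
| orb_fwd k q : gdom q -> @orb i p (gsrc (g k)) q -> @orb i p (gdst (g k)) (gmap q)
| orb_bwd k q : gdom q -> @orb i p (gdst (g k)) (gmap q) -> @orb i p (gsrc (g k)) q.

Lemma orb_lab i (p : wdom (W i)) j (q : wdom (W j)) : orb p q ->
  wlab _ q = wlab _ p \/ wlab _ q = linv (wlab _ p).
Proof.
elim=> {j q} [|k q Uq _|k q Uq _].
- by left.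
- by rewrite gmap_lab // => -[] ->; [right|left; rewrite linvK].
- rewrite gmap_lab // => -[e|e]; [right|left].
    by rewrite -e linvK.
  by rewrite -[LHS]linvK e linvK.
Qed.

Lemma orb_finite i (p : wdom (W i)) j : finite_set (@orb i p j).
Proof.
apply: (@sub_finite_set _ _ (wlab (W j) @^-1` [set wlab _ p] `|`
   wlab (W j) @^-1` [set linv (wlab _ p)])).
  by move=> q /orb_lab[] e; [left|right].
by rewrite finite_setU; split; exact: wlab_finite.
Qed.

(* Travelling along an orbit carries the whole block of the starting point. *)
Lemma orb_blk i (p : wdom (W i)) j (q : wdom (W j)) : orb p q ->
  exists (e : bool) (f : wdom (W i) -> wdom (W j)), [/\ f p = q,
    forall x, blk p x -> blk q (f x),
    forall x y, blk p x -> blk p y -> (x < y)%O ->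
      if e then (f y < f x)%O else (f x < f y)%O &
    forall x, blk p x -> wlab _ (f x) = if e then linv (wlab _ x) else wlab _ x].
Proof.
elim=> {j q} [|k q Uq _ [e [f [fp fb fm fl]]]|k q Uq _ [e [f [fp fb fm fl]]]].
- by exists false, id.
- have U x (px : blk p x) : gdom (f x) := blk_dom (fb x px) Uq.
  exists (~~ e), (@gmap (g k) \o f); split => /=.
  + by rewrite fp.
  + by move=> x px; apply: blk_gmap (fb x px).
  + move=> x y px py xy; have := fm x y px py xy.
    by case: e {fm fl} => /= ?; apply: gmap_anti => //; exact: U.
  + move=> x px; rewrite gmap_lab ?fl//; last exact: U.
    by case: e {fm fl} => //=; rewrite linvK.
- have /choice[h hP] : forall x, exists y, blk p x ->
      [/\ @gdom (g k) y, gmap y = f x & blk q y].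
    move=> x; have [px|npx] := pselect (blk p x); last by exists q.
    by have [y yP] := blk_cod Uq (fb x px); exists y.
  exists (~~ e), h; split.
  + by have [Uh + _] := hP p (blk_refl p); rewrite fp; exact: gmap_inj.
  + by move=> x px; have [] := hP x px.
  + move=> x y px py xy; have [Ux ex _] := hP x px; have [Uy ey _] := hP y py.
    have := fm x y px py xy; rewrite -ex -ey.
    by case: e {fm fl} => /=; rewrite !ltNge gmap_anti_le.
  + move=> x px; have [Ux ex _] := hP x px; have := fl x px.
    rewrite -ex gmap_lab // => e1.
    case: e {fm fl} e1 => /= e1; last by rewrite -e1 linvK.
    by rewrite -[LHS]linvK e1 linvK.
Qed.

(** If [f] moved [x], the iterates of [x] would form a strictly monotone sequence of letters with
    one and the same label, which is impossible since each label occurs finitely often. *)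
Lemma blk_self_id i (p : wdom (W i)) (f : wdom (W i) -> wdom (W i)) :
    (forall x, blk p x -> blk p (f x)) ->
    (forall x y, blk p x -> blk p y -> (x < y)%O -> (f x < f y)%O) ->
    (forall x, blk p x -> wlab (W i) (f x) = wlab (W i) x) ->
  forall x, blk p x -> f x = x.
Proof.
move=> fb fm fl x px.
have itb n y : blk p y -> blk p (iter n f y).
  by move=> py; elim: n => //= n; exact: fb.
have itl n y : blk p y -> wlab _ (iter n f y) = wlab _ y.
  by move=> py; elim: n => //= n <-; apply: fl; exact: itb.
(* [R] will be the strict order and then its converse. *)
have inf (R : rel (wdom (W i))) : transitive R -> irreflexive R ->
    (forall x y, blk p x -> blk p y -> R x y -> R (f x) (f y)) -> ~~ R x (f x).
  move=> Rt Ri Rf; apply/negP => Rx.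
  have step n : R (iter n f x) (iter n.+1 f x).
    elim: n => //= n IH; apply: Rf => //; [exact: itb|].
    by apply: fb; exact: itb.
  have mon m n : m < n -> R (iter m f x) (iter n f x).
    elim: n => // n IH; rewrite ltnS leq_eqVlt => /orP[/eqP->|/IH h]; first exact: step.
    exact: Rt h (step n).
  have inj : injective (fun n => iter n f x).
    move=> m n e; case: (ltngtP m n) => // /mon; rewrite e Ri //.
  apply: infinite_nat.
  have fin := @wlab_finite _ (W i) (wlab _ x).
  have : finite_set ((fun n => iter n f x) @` [set: nat]).
    apply: sub_finite_set fin => _ [n _ <-] /=; exact: itl.
  rewrite (eq_finite_set (inj_card_eq _)) // => m n _ _; exact: inj.
have h1 := inf _ lt_trans ltxx fm.
have h2 : ~~ (f x < x)%O.
  by apply: (inf (fun a b => b < a)%O) => [a b c ab bc|a|a b pa pb];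
    [exact: lt_trans bc ab|exact: ltxx|exact: fm].
by move: h1 h2; rewrite -!leNgt => h1 h2; apply/le_anti/andP.
Qed.

(** Otherwise the orbit carries the block of [p] into itself. An increasing map is the identity, so
    [q = p]. A decreasing one inverts the letters and is an involution by [blk_self_id], hence it
    gives a cancellation on the interval between [p] and [q], against reducedness. *)
Lemma orb_blk_eq i (p q : wdom (W i)) : reduced (W i) ->
  orb p q -> blk p q -> q = p.
Proof.
move=> red /orb_blk[e [f [fp fb fm fl]]] pq.
have {}fb x : blk p x -> blk p (f x) by move=> px; apply: blk_trans pq (fb x px).
case: e fm fl => fm fl; last by rewrite -fp; exact: blk_self_id fb fm fl _ _.
have ffK x : blk p x -> f (f x) = x.
  apply: (@blk_self_id i p (f \o f)) => //= {}x.
  - by move=> px; apply: (fb _ (fb _ px)).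
  - by move=> y px py xy; apply: (fm (f y) (f x)); [exact: fb|exact: fb|exact: fm].
  - by move=> px; rewrite !fl ?linvK//; exact: fb.
have fm' x y : blk p x -> blk p y -> (x <= y)%O -> (f y <= f x)%O.
  by move=> px py; rewrite le_eqVlt => /orP[/eqP->//|/fm h]; apply/ltW/h.
have [lo [hi [plo phi lohi]]] : exists lo hi, [/\ blk p lo, f lo = hi & (lo <= hi)%O].
  case: (leP p q) => h; [by exists p, q|exists q, p; split => //; last exact: ltW].
  by rewrite -fp ffK.
exfalso; apply: red; exists [set x | (lo <= x <= hi)%O], f.
have phib : blk p hi by rewrite -phi; exact: fb.
have bT x : (lo <= x <= hi)%O -> blk p x.
  move=> h; apply: (blk_trans plo); apply: blk_convex h.
  exact: blk_trans (blk_sym plo) phib.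
have hib : f hi = lo by rewrite -phi ffK.
have fT x : (lo <= x <= hi)%O -> (lo <= f x <= hi)%O.
  move=> h; have px := bT _ h; case/andP: h => h1 h2; apply/andP; split.
    by rewrite -hib; exact: fm'.
  by rewrite -phi; exact: fm'.
split; first by exists lo; rewrite /= lexx.
move=> t Tt; split.
- by split; [exact: fT|apply: ffK; exact: bT].
- apply/seteqP; split => [x|x []//]; rewrite in_witv => /andP[tx xft].
  split; last by rewrite in_witv; apply/andP.
  case/andP: Tt (fT _ Tt) => lt _ /andP[_ fth]; apply/andP; split.
    exact: le_trans lt tx.
  exact: le_trans xft fth.
- have sub x : [set x | (lo <= x <= hi)%O] x -> (t <= x <= f t)%O -> (t <= f x <= f t)%O.
    move=> Tx /andP[tx xft]; apply/andP; split.
      by rewrite -(ffK t (bT _ Tt)); apply: fm' => //; [exact: bT|exact: fb (bT _ Tt)].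
    by apply: fm' => //; exact: bT.
  apply/seteqP; split => [x [Tx]|y [x [Tx]]].
    rewrite in_witv => h; exists (f x); last by apply: ffK; exact: bT.
    by split; [exact: fT|rewrite in_witv; exact: sub].
  by rewrite in_witv => h <-; split; [exact: fT|rewrite in_witv; exact: sub].
- by rewrite fl //; exact: bT.
Qed.
End Gluing.

(** If two letters of a convex reduced factor were partners, the interval between them would be a
    cancellation of that factor. *)
Lemma pairing_no_self A (u w : word A) (f : wdom u -> wdom w) star :
  reduced u -> {mono f : x y / (x <= y)%O} -> (forall x, wlab w (f x) = wlab u x) ->
  (forall x y z, (f x <= z <= f y)%O -> exists z', f z' = z) ->
  pairing setT star -> forall p q, star (f p) <> f q.
Proof.
move=> ru fm fl fc pT p q.
wlog pq : p q / (p <= q)%O.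
  move=> h; case: (leP p q) => [|/ltW] /h; first by [].
  by move=> hqp e; apply: hqp; rewrite -e; have [_ ->] := pT (f p) I.
move=> e; have [_ _ _ h] := pT (f p) I; rewrite e in h.
apply: (pairing_not_reduced (T' := [set x | (p <= x <= q)%O]) fm fl pT) ru.
- by exists p; rewrite /= lexx.
- move=> x /= pxq; split => //; have [|_ sx] := h (f x); first by rewrite !fm.
  by have [y fy] := fc _ _ _ sx; exists y => //; move: sx; rewrite -fy !fm.
- by move=> x y z /andP[px _] /andP[_ yq] _ /andP[xz zy]; rewrite /= (le_trans px xz) (le_trans zy yq).
Qed.

(** * Gluings obtained from three words with trivial product *)

Section Triples.
Local Open Scope group_scope.
Variables (A : Type) (I : Type) (W : I -> word A) (G : groupType).

(** The first two factors stand for the value of the glued final segment; it has to be inverse to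
    the value of its image. *)
Definition respects (om : forall i, set (wdom (W i)) -> G) (h : gluing W) :=
  (om _ (~` gdom (g := h)))^-1 * om _ [set: wdom (W (gsrc h))] *
  om _ (gmap (g := h) @` gdom (g := h)) = 1.

Lemma make_gluing w (star : wdom w -> wdom w) i j
    (f : wdom (W i) -> wdom w) (f' : wdom (W j) -> wdom w) :
  pairing setT star -> injective f' ->
  (forall x, wlab w (f x) = wlab (W i) x) -> (forall x, wlab w (f' x) = wlab (W j) x) ->
  (forall p p' q, star (f p) = f' q -> (p < p')%O -> exists q', star (f p') = f' q') ->
  (forall p q q', star (f p) = f' q -> (q' < q)%O -> exists p', star (f p') = f' q') ->
  (forall p p' q q', star (f p) = f' q -> star (f p') = f' q' -> (p < p')%O -> (q' < q)%O) ->
  exists2 h : gluing W, gsrc h = i & forall om, (forall k, om k set0 = 1) ->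
    respects om h ->
    (om i (~` [set p | exists q, star (f p) = f' q]))^-1 * om i setT *
      om j [set q | exists p, star (f p) = f' q] = 1.
Proof.
move=> pT f'inj fl fl' up down anti.
pose U := [set p | exists q, star (f p) = f' q].
have [[p0 [q0 pq0]]|U0] := pselect (exists p, U p); last first.
  have E1 : U = set0 by apply/seteqP; split => // p Up; case: U0; exists p.
  have E2 : [set q | exists p, star (f p) = f' q] = set0.
    by apply/seteqP; split => // q [p pq]; case: U0; exists p, q.
  unshelve eexists (@Gluing _ _ W i i set0 id _ _ _ _) => //.
  by move=> om om0 _; rewrite -/U E1 E2 setC0 om0 mulg1 mulVg.
(* When nothing is glued, an empty gluing from [W i] to itself serves; this is why only the source
   of the gluing is recorded. *)
have /choice[t tP] : forall p, exists q, U p -> star (f p) = f' q.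
  move=> p; have [[q pq]|nUp] := pselect (U p); first by exists q.
  by exists q0.
have tU p q : star (f p) = f' q -> t p = q.
  by move=> pq; apply: f'inj; rewrite -tP //; exists q.
unshelve eexists (@Gluing _ _ W i j U t _ _ _ _) => //.
- move=> p q; rewrite le_eqVlt => /orP[/eqP->//|pq] [r pr].
  exact: up pr pq.
- move=> p q Up; rewrite le_eqVlt => /orP[/eqP->|qp]; first by exists p.
  have [r rq] := down _ _ _ (tP p Up) qp; exists r; last exact: tU.
  by exists q.
- by move=> p q Up Uq; apply: anti; exact: tP.
- move=> p Up; rewrite -fl' -tP // -fl; by have [_ _ ->] := pT (f p) Logic.I.
- move=> om _; rewrite /respects /=; congr (_ * _ * om j _ = _).
  apply/seteqP; split => [q [p Up <-]|q [p pq]]; first by exists p; exact: tP.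
  by exists p; [exists q|exact: tU].
Qed.

(** As no pair lies inside one word, each word is an initial segment glued to the previous word
    followed by a final segment glued to the next, in cyclic order. With [a], [b], [c] the values of
    the three initial segments, the words have values [a * b^-1], [b * c^-1] and [c * a^-1]. *)
Lemma triple_gluings i j k : reduced (W i) -> reduced (W j) -> reduced (W k) ->
  (exists star, pairing [set: wdom (wcat (W i) (wcat (W j) (W k)))] star) ->
  exists h1 h2 h3 : gluing W, [/\ gsrc h1 = i, gsrc h2 = j, gsrc h3 = k &
    forall om, (forall k, om k set0 = 1) ->
      respects om h1 -> respects om h2 -> respects om h3 ->
      om i setT * om j setT * om k setT = 1].
Proof.
move=> ri rj rk [star pT].
set w := wcat _ _ in star pT.
pose fi (x : wdom (W i)) : wdom w := inl x.
pose fj (x : wdom (W j)) : wdom w := inr (inl x).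
pose fk (x : wdom (W k)) : wdom w := inr (inr x).
have fim : {mono fi : x y / (x <= y)%O} by [].
have fjm : {mono fj : x y / (x <= y)%O} by [].
have fkm : {mono fk : x y / (x <= y)%O} by [].
have stK t : star (star t) = t by have [] := pT t Logic.I.
have stI t x : (t <= x <= star t)%O -> (t <= star x <= star t)%O.
  by move=> h; have [_ _ _ /(_ x h)[]] := pT t Logic.I.
have [ij ji] : (forall x y, (fi x <= fj y)%O) /\ (forall x y, (fj x <= fi y)%O = false).
  by [].
have [ik ki] : (forall x y, (fi x <= fk y)%O) /\ (forall x y, (fk x <= fi y)%O = false).
  by [].
have [jk kj] : (forall x y, (fj x <= fk y)%O) /\ (forall x y, (fk x <= fj y)%O = false).
  by [].
have fE t : [\/ exists x, t = fi x, exists x, t = fj x | exists x, t = fk x].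
  by case: t => [x|[x|x]]; [apply: Or31|apply: Or32|apply: Or33]; exists x.
have nii : forall p q, star (fi p) <> fi q.
  apply: (pairing_no_self ri fim) => // x y z; have [] := fE z => -[t ->].
  - by exists t.
  - by rewrite ji andbF.
  - by rewrite ki andbF.
have njj : forall p q, star (fj p) <> fj q.
  apply: (pairing_no_self rj fjm) => // x y z; have [] := fE z => -[t ->].
  - by rewrite ji.
  - by exists t.
  - by rewrite kj andbF.
have nkk : forall p q, star (fk p) <> fk q.
  apply: (pairing_no_self rk fkm) => // x y z; have [] := fE z => -[t ->].
  - by rewrite ki.
  - by rewrite kj.
  - by exists t.
have stS t u : star t = u -> star u = t by move=> <-.
(* Two adjacent factors [f < f'] of the cyclic word. *)
have adj a b (f : wdom (W a) -> wdom w) (f' : wdom (W b) -> wdom w) :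
    {mono f : x y / (x <= y)%O} -> {mono f' : x y / (x <= y)%O} ->
    (forall x, wlab w (f x) = wlab (W a) x) -> (forall x, wlab w (f' x) = wlab (W b) x) ->
    (forall p q, star (f p) <> f q) -> (forall p q, star (f' p) <> f' q) ->
    (forall x y, (f x <= f' y)%O) ->
    (forall x y z, (f x <= z <= f' y)%O -> (exists t, z = f t) \/ (exists t, z = f' t)) ->
    exists2 h : gluing W, gsrc h = a & forall om, (forall k, om k set0 = 1) ->
      respects om h ->
      (om a (~` [set p | exists q, star (f p) = f' q]))^-1 * om a setT *
        om b [set q | exists p, star (f p) = f' q] = 1.
  move=> fm f'm fl f'l nf nf' ff' cv.
  have f'inj : injective f'.
    by move=> x y e; apply/le_anti; rewrite -!f'm e lexx.
  apply: (make_gluing pT) => //.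
  - move=> p p' q pq /ltW pp'.
    have [||] := cv p q (star (f p')).
    + by rewrite -pq; apply: stI; rewrite pq ff' fm pp'.
    + by move=> [t /nf].
    + by [].
  - move=> p q q' pq /ltW qq'.
    have [|[t e]|[t /nf' //]] := cv p q (star (f' q')).
      by rewrite -pq; apply: stI; rewrite pq ff' f'm.
    by exists t; exact: stS.
  - move=> p p' q q' pq p'q' pp'; rewrite lt_neqAle; apply/andP; split.
      apply/eqP => qq'; move: pp'; rewrite ltNge -fm.
      by rewrite -(stS _ _ p'q') qq' -pq stK lexx.
    have := stI (f p) (f p'); rewrite p'q' pq fm (ltW pp') ff' f'm.
    by move=> /(_ isT)/andP[].
have [h1 h1i h1P] := adj i j fi fj fim fjm (fun=> erefl) (fun=> erefl) nii njj ij
  ltac:(by move=> x y z; have [] := fE z => -[t ->]; rewrite ?kj ?andbF // => _;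
     [left|right]; exists t).
have [h2 h2i h2P] := adj j k fj fk fjm fkm (fun=> erefl) (fun=> erefl) njj nkk jk
  ltac:(by move=> x y z; have [] := fE z => -[t ->]; rewrite ?ji ?andbF // => _;
     [left|right]; exists t).
have fiinj : injective fi by move=> x y [].
(* The gluing from the last word back to the first: its pairs enclose the middle word, so [adj] does
   not apply. *)
have [|||||h3 h3i h3P] := @make_gluing w star k i fk fi pT fiinj => //.
- move=> p p' q pq pp'; have [] := fE (star (fk p')) => -[t e].
  + by exists t.
  + have := stI (fi q) (fj t); rewrite (stS _ _ pq) (stS _ _ e) ij jk fkm => /(_ isT)/andP[_].
    by rewrite leNgt pp'.
  + by case: (nkk _ _ e).
- move=> p q q' pq qq'; have [] := fE (star (fi q')) => -[t e].
  + by case: (nii _ _ e).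
  + have := stI (fi q) (fj t); rewrite (stS _ _ pq) (stS _ _ e) ij jk fim => /(_ isT)/andP[].
    by rewrite leNgt qq'.
  + by exists t; exact: stS.
- move=> p p' q q' pq p'q' pp'; rewrite ltNge; apply/negP => qq'.
  have := stI (fi q) (fi q'); rewrite (stS _ _ pq) (stS _ _ p'q') fim qq' ik fkm.
  by move=> /(_ isT)/andP[_]; rewrite leNgt pp'.
exists h1, h2, h3; split => // om om0 /h1P o1 /h2P o2 /h3P o3.
have {}o1 := o1 om0; have {}o2 := o2 om0; have {}o3 := o3 om0.
have E1 : ~` [set p | exists q, star (fi p) = fj q] = [set q | exists p, star (fk p) = fi q].
  apply/seteqP; split => q /= => [nq|[p /stS pq] [r]]; last by rewrite pq.
  have [] := fE (star (fi q)) => -[t e].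
  - by case: (nii _ _ e).
  - by case: nq; exists t.
  - by exists t; exact: stS.
have E2 : ~` [set p | exists q, star (fj p) = fk q] = [set q | exists p, star (fi p) = fj q].
  apply/seteqP; split => q /= => [nq|[p /stS pq] [r]]; last by rewrite pq.
  have [] := fE (star (fj q)) => -[t e].
  - by exists t; exact: stS.
  - by case: (njj _ _ e).
  - by case: nq; exists t.
have E3 : ~` [set p | exists q, star (fk p) = fi q] = [set q | exists p, star (fj p) = fk q].
  apply/seteqP; split => q /= => [nq|[p /stS pq] [r]]; last by rewrite pq.
  have [] := fE (star (fk q)) => -[t e].
  - by case: nq; exists t.
  - by exists t; exact: stS.
  - by case: (nkk _ _ e).
rewrite E1 in o1; rewrite E2 in o2; rewrite E3 in o3.
have solve (a b x : G) : a^-1 * x * b = 1 -> x = a * b^-1.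
  by move=> /eqP; rewrite mulg_eq1 => /eqP <-; rewrite mulVKg.
by rewrite (solve _ _ _ o1) (solve _ _ _ o2) (solve _ _ _ o3) !mulgA !mulgVK mulgV.
Qed.
End Triples.

(** * Marks *)

Section Parity.
Definition parity (T : choiceType) (X : set T) : bool := odd #|` fset_set X|.

Lemma parity0 (T : choiceType) : parity (set0 : set T) = false.
Proof. by rewrite /parity fset_set0 cardfs0. Qed.

Lemma parity1 (T : choiceType) (x : T) : parity [set x] = true.
Proof. by rewrite /parity fset_set1 cardfs1. Qed.

Lemma parityU (T : choiceType) (X Y : set T) : finite_set X -> finite_set Y ->
  X `&` Y = set0 -> parity (X `|` Y) = parity X (+) parity Y.
Proof.
move=> fX fY XY0; rewrite /parity fset_setU // cardfsU -fset_setI // XY0.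
by rewrite fset_set0 cardfs0 subn0 oddD.
Qed.

Lemma parity_image (T U : choiceType) (f : T -> U) (X : set T) :
  finite_set X -> {in X &, injective f} -> parity (f @` X) = parity X.
Proof.
move=> fX finj; rewrite /parity fset_set_image // card_in_imfset //.
by move=> x y; rewrite !in_fset_set //; exact: finj.
Qed.
End Parity.

Section Marks.
Variables (A : Type) (I : Type) (W : I -> word A).
Variables (K : finType) (g : K -> gluing W).
Hypothesis Wred : forall i, reduced (W i).

Notation point := {i : I & wdom (W i)}.
Notation real := (real g).
Notation orb := (orb g).

(** For fixed [L] and varying [o], this is the vector modulo 2 attached to the cut [L]; [gen] and
    [comb] below give finitely many vectors and their linear combinations. *)
Definition chi (o : point) i (L : set (wdom (W i))) : bool :=
  parity (L `&` @orb _ (projT2 o) i).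

Lemma chi_finite (o : point) i (L : set (wdom (W i))) :
  finite_set (L `&` @orb _ (projT2 o) i).
Proof. by apply: finite_setI; right; exact: orb_finite. Qed.

Lemma chiU o i (L M : set (wdom (W i))) :
  L `&` M = set0 -> chi o (L `|` M) = chi o L (+) chi o M.
Proof.
move=> LM; rewrite /chi setIUl; apply: parityU; try exact: chi_finite.
by rewrite setIACA LM set0I.
Qed.

Lemma chi_split o i (L M : set (wdom (W i))) :
  L `<=` M -> chi o M = chi o L (+) chi o (M `\` L).
Proof.
move=> LM; rewrite -chiU; last by rewrite setDE setICA setICr setI0.
by rewrite setDUK.
Qed.

Lemma chi_gmap o k (L : set (wdom (W (gsrc (g k))))) :
  L `<=` gdom (g := g k) -> chi o (gmap (g := g k) @` L) = chi o L.
Proof.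
move=> LU; rewrite /chi.
rewrite -(@parity_image _ _ (gmap (g := g k)) (L `&` _)).
- congr parity; apply/seteqP; split => [_ [[p Lp <-] op]|_ [p [Lp op] <-]].
    by exists p => //; split => //; apply: orb_bwd op; exact: LU.
  by split; [exists p|apply: orb_fwd => //; exact: LU].
- exact: chi_finite.
- move=> p q /set_mem[/LU Up _] /set_mem[/LU Uq _]; exact: gmap_inj.
Qed.

Definition gen (o : point) (c : K + K) : bool :=
  match c with
  | inl k => chi o [set: wdom (W (gsrc (g k)))]
  | inr k => chi o (~` gdom (g := g k))
  end.

Definition comb (e : {ffun K + K -> bool}) (o : point) : bool :=
  \big[addb/false]_c (e c && gen o c).

Lemma comb_flip (e : {ffun K + K -> bool}) c o :
  comb [ffun d => e d (+) (d == c)] o = comb e o (+) gen o c.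
Proof.
rewrite /comb; under eq_bigr do rewrite ffunE andb_addl.
rewrite big_split /=; congr addb.
rewrite (bigD1 c) //= eqxx /= big1 ?addbF // => d /negbTE ->.
by [].
Qed.

(** A gluing preserves the number of letters of an orbit, so transporting a cut only adds the vector
    of the whole source word. *)
Lemma real_chi i (L : set (wdom (W i))) :
  real L -> exists e, forall o, chi o L = comb e o.
Proof.
have comb0 o : comb [ffun=> false] o = false.
  by rewrite /comb big1 // => c _; rewrite ffunE.
elim=> {i L} [i|k|k L _ [e IH] UL|k L _ [e IH] LD].
- by exists [ffun=> false] => o; rewrite comb0 /chi set0I parity0.
- exists [ffun d => [ffun=> false] d (+) (d == inr k)] => o.
  by rewrite comb_flip comb0.
- exists [ffun d => e d (+) (d == inl k)] => o.
  rewrite comb_flip -IH chi_gmap; last by move=> p [].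
  rewrite /= (chi_split o (@subsetT _ L)) addbA addbb addFb.
  congr chi; apply/seteqP; split => p [] //= Up nLp; split => //.
  by apply: contrapT => /UL.
- exists [ffun d => e d (+) (d == inl k)] => o.
  rewrite comb_flip -IH /=; set M := [set p | _].
  have -> : L = gmap (g := g k) @` (setT `\` M).
    apply/seteqP; split => [q Lq|_ [p [_ /not_implyP[Up /contrapT Lp]] <-] //].
    have [p Up pq] := LD q Lq; exists p => //; split => //= h.
    by apply: (h Up); rewrite pq.
  rewrite chi_gmap; last by move=> p [_ /not_implyP[]].
  by rewrite [chi o setT](chi_split o (@subsetT _ M)) addbC -addbA addbb addbF.
Qed.

(** The orbit of [s] meets the word in finitely many letters, and [orb_blk_eq] gives a real cut
    between [s] and each other one. Moving [L] up or [M] down to these cuts removes the other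
    letters one by one. *)
Lemma real_isolate i (L M : set (wdom (W i))) s : real L -> real M -> M s -> ~ L s ->
  exists L' M', [/\ real L', real M', L `<=` L', M' `<=` M &
    (M' `\` L') `&` @orb _ s i = [set s]].
Proof.
move=> rL rM Ms nLs.
have /finite_seqP[qs qsE] : finite_set (@orb _ s i) by exact: orb_finite.
suff [L' [M' [rL' rM' LL' MM' [M's nL's h]]]] : exists L' M',
    [/\ real L', real M', L `<=` L', M' `<=` M &
     [/\ M' s, ~ L' s & forall q, q \in qs -> M' q -> ~ L' q -> q = s]].
  exists L', M'; split => //; apply/seteqP; split => [q [[M'q nL'q] oq]|_ ->].
    by apply: h => //; move: oq; rewrite qsE.
  by split; [split|exact: orb_refl].
have : {subset qs <= qs} by [].
elim: {1 3}qs => [_|q qs' IH sub].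
  by exists L, M; split.
have [|L' [M' [rL' rM' LL' MM' [M's nL's h]]]] := IH.
  by move=> r rq; apply: sub; rewrite inE rq orbT.
have [->|qs0] := pselect (q = s).
  exists L', M'; split => //; split => // r; rewrite inE => /orP[/eqP->//|]; exact: h.
have oq : @orb _ s i q.
  have : [set` qs] q by apply: sub; exact: mem_head.
  by rewrite -qsE.
have : ~ blk g s q by move=> sq; apply: qs0; exact: orb_blk_eq oq sq.
move=> /existsNP[N /not_implyP[rN nN]].
have [Ns|nNs] := pselect (N s).
  have nNq : ~ N q by move=> Nq; apply: nN.
  have [] := real_total rM' rN => sMN.
    exists L', M'; split => //; split => // r; rewrite inE => /orP[/eqP->|]; last exact: h.
    by move=> /sMN.
  exists L', N; split => //; [exact: subset_trans sMN MM'|split => // r].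
   rewrite inE => /orP[/eqP->//|rq Nr]; apply: h => //; exact: sMN.
have Nq : N q.
  by apply: contrapT => nNq; apply: nN.
have [] := real_total rN rL' => sNL.
  exists L', M'; split => //; split => // r; rewrite inE => /orP[/eqP->|]; last exact: h.
  by move=> _; case; exact: sNL.
exists N, M'; split => //; [exact: subset_trans LL' sNL|split => // r].
 rewrite inE => /orP[/eqP->//|rq M'r nNr]; apply: h => //.
by move=> /sNL.
Qed.

(** For each of the finitely many pairs of distinct combinations one orbit where they differ is
    chosen, and the marks are the letters of these orbits. After isolation of a letter [s], the
    vectors of [L'] and [M'] differ at the orbit of [s]. The orbit chosen for this pair then has an
    odd number of letters between the two cuts, hence at least one. *)
Lemma exists_marks : exists Z : forall i, set (wdom (W i)),
  [/\ forall i, finite_set (Z i),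
      forall k p, gdom (g := g k) p -> Z _ p <-> Z _ (gmap p) &
      forall i (L M : set (wdom (W i))), real L -> real M -> ~ M `<=` L ->
        exists z, [/\ Z _ z, M z & ~ L z]].
Proof.
pose E := ({ffun K + K -> bool} * {ffun K + K -> bool})%type.
have /choice[N NP] : forall e : E, exists o : option point,
    (exists p, comb e.1 p <> comb e.2 p) ->
    exists2 p, o = Some p & comb e.1 p <> comb e.2 p.
  move=> e; have [[p ep]|nep] := pselect (exists p, comb e.1 p <> comb e.2 p).
    by exists (Some p) => _; exists p.
  by exists None.
pose Z i : set (wdom (W i)) :=
  [set q | exists e p, N e = Some p /\ orb (projT2 p) q].
exists Z; split.
- move=> i; have -> : Z i = \bigcup_(e in [set: E])
      [set q | exists p, N e = Some p /\ orb (projT2 p) q].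
    by apply/seteqP; split => [q [e [p h]]|q [e _ [p h]]]; exists e => //; exists p.
  apply: bigcup_finite; first exact: finite_finset.
  move=> e _; case: (N e) => [p|].
    apply: sub_finite_set (@orb_finite _ _ _ _ g _ (projT2 p) i).
    by move=> q [_ [[<-]]].
  by apply: sub_finite_set (finite_set0 _) => q [p []].
- move=> k p Up; split=> -[e [o [h op]]]; exists e, o; split => //.
    exact: orb_fwd.
  exact: orb_bwd op.
- move=> i L M rL rM /existsNP[s /not_implyP[Ms nLs]].
  have [L' [M' [rL' rM' LL' MM' iso]]] := real_isolate rL rM Ms nLs.
  have [M's nL's] : (M' `\` L') s.
    suff : ((M' `\` L') `&` @orb _ s i) s by case.
    by rewrite iso.
  have LM' : L' `<=` M' by have [//|/(_ _ M's)] := real_total rL' rM'.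
  have [e eP] := real_chi rM'; have [e' eP'] := real_chi rL'.
  have neq : comb e (existT _ i s) <> comb e' (existT _ i s).
    rewrite -eP -eP' (chi_split _ LM') [chi _ (_ `\` _)]/chi /= iso parity1.
    by rewrite addbT; case: chi.
  have [|p Np] := NP (e, e'); first by exists (existT _ i s).
  rewrite /= -eP -eP'.
  rewrite (chi_split _ LM') [chi _ (_ `\` _)]/chi.
  have [->|/set0P[z [[M'z nL'z] oz]] _] := eqVneq ((M' `\` L') `&` @orb _ (projT2 p) i) set0.
    by rewrite parity0 addbF.
  exists z; split; [by exists (e, e'), p|exact: MM'|by move=> /LL'].
Qed.
End Marks.

(** * Products over the marks *)

Section Transport.
Local Open Scope group_scope.
Variables (A : Type) (I : Type) (W : I -> word A).
Variables (K : finType) (g : K -> gluing W).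

Definition upto i (p : wdom (W i)) : set (wdom (W i)) := [set x | (x <= p)%O].
Definition below i (p : wdom (W i)) : set (wdom (W i)) := [set x | (x < p)%O].

Notation U k := (gdom (g := g k)).
Notation tau k := (gmap (g := g k)).

(** The class of a transported cut; it is the source of all the identities below relating marks to
    their images. *)
Lemma cls_gmap k (L : set (wdom (W (gsrc (g k))))) :
  (forall x y, L y -> (x <= y)%O -> L x) -> ~` U k `<=` L ->
  cls (tau k @` (U k `\` L)) = (cls [set: wdom (W (gsrc (g k)))])^-1 * cls L.
Proof.
move=> Ld UL; rewrite cls_anti; first last.
- by move=> x [Ux _]; exact: gmap_lab.
- by move=> x y [Ux _] [Uy _]; exact: gmap_anti.
rewrite (cls_split Ld (@subsetT _ L)) invgM -mulgA mulVg mulg1.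
congr (_^-1); congr cls; apply/seteqP; split => x [Ux nLx]; split => //.
by apply: contrapT => /UL.
Qed.

Lemma compl_dom_sub k p (L : set (wdom (W (gsrc (g k))))) :
  U k p -> (forall x, (x < p)%O -> L x) -> ~` U k `<=` L.
Proof.
move=> Up Lp x nUx; apply: Lp; rewrite ltNge; apply/negP => px.
by apply: nUx; exact: gdom_up Up.
Qed.

Lemma cls_below_gmap k p : U k p ->
  cls (below (tau k p)) = (cls [set: wdom (W (gsrc (g k)))])^-1 * cls (upto p).
Proof.
move=> Up; rewrite -cls_gmap; first last.
- by apply: compl_dom_sub Up _ => x; exact: ltW.
- by move=> x y /= yp xy; exact: le_trans xy yp.
congr cls; apply/seteqP; split => [y yp|y [r [Ur /negP nrp] <-]].
  have [r Ur rE] := gcod_down Up (ltW yp); exists r => //; split => //= rp.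
  by move: yp; rewrite -rE /below /= ltNge gmap_anti_le // rp.
by rewrite /below /= ltNge gmap_anti_le.
Qed.

Lemma cls_upto_gmap k p : U k p ->
  cls (upto (tau k p)) = (cls [set: wdom (W (gsrc (g k)))])^-1 * cls (below p).
Proof.
move=> Up; rewrite -cls_gmap; first last.
- exact: compl_dom_sub Up _.
- by move=> x y /= yp xy; exact: le_lt_trans xy yp.
congr cls; apply/seteqP; split => [y yp|y [r [Ur /negP]]].
  have [r Ur rE] := gcod_down Up yp; exists r => //; split => //= rp.
  move: yp; rewrite -rE /upto /= gmap_anti_le // => pr.
  by have := lt_le_trans rp pr; rewrite ltxx.
by rewrite -leNgt => pr <-; rewrite /upto /= gmap_anti_le.
Qed.

Lemma cls_cod k :
  cls (tau k @` U k) = (cls [set: wdom (W (gsrc (g k)))])^-1 * cls (~` U k).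
Proof.
rewrite -cls_gmap //; first by rewrite setDE setCK setIid.
by move=> x y nUy xy Ux; apply: nUy; exact: gdom_up Ux.
Qed.
End Transport.

(** * The value of a cut, and its behaviour under gluings *)

Section Potential.
Local Open Scope group_scope.
Variables (A : Type) (I : Type) (W : I -> word A).
Variables (K : finType) (g : K -> gluing W).
Notation U k := (gdom (g := g k)).
Notation tau k := (gmap (g := g k)).

Variable Z : forall i, set (wdom (W i)).
Hypothesis Z_finite : forall i, finite_set (@Z i).
Hypothesis Z_gmap : forall k p, U k p -> Z p <-> Z (tau k p).
Hypothesis Z_sep : forall i (L M : set (wdom (W i))), real g L -> real g M ->
  ~ M `<=` L -> exists z, [/\ Z z, M z & ~ L z].

Variables (G : groupType) (S : {pred BF A}) (psi phi : BF A -> G).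
Hypothesis S_mul : forall x y, x \in S -> y \in S -> x * y \in S.
Hypothesis S_inv : forall x, x \in S -> x^-1 \in S.
Hypothesis psiM : forall x y, x \in S -> y \in S -> psi (x * y) = psi x * psi y.
Hypothesis psi1 : psi 1 = 1.
Hypothesis psiV : forall x, psi x^-1 = (psi x)^-1.
Hypothesis phi1 : phi 1 = 1.
Hypothesis phiM : forall h x, h \in S -> phi (h * x) = psi h * phi x.

Lemma Z_sepE i (L M : set (wdom (W i))) : real g L -> real g M ->
  (forall z, Z z -> M z -> L z) -> M `<=` L.
Proof.
move=> rL rM h; apply: contrapT => /(Z_sep rL rM)[z [Zz Mz nLz]].
exact: nLz (h z Zz Mz).
Qed.

Definition marks i : seq (wdom (W i)) := sort <=%O (enum_fset (fset_set (@Z i))).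

Lemma mem_marks i p : (p \in marks i) = `[< Z p >].
Proof.
rewrite mem_sort in_fset_set; last exact: Z_finite.
by apply/idP/idP => [/set_mem Zp|/asboolP Zp]; [exact/asboolP|exact/mem_set].
Qed.

Lemma marks_sorted i : pairwise <%O (marks i).
Proof.
by rewrite -sorted_pairwise; [rewrite sort_lt_sorted fset_uniq|exact: lt_trans].
Qed.

(* Between two consecutive marks there is at most one real cut; the part
   before it and the inverse of the part after it are measured by [phi]. *)
Definition gap i (p q : wdom (W i)) : G :=
  if pselect (exists L, [/\ real g L, L p & ~ L q]) is left h then
    phi ((cls (upto p))^-1 * cls (projT1 (cid h))) *
    (phi ((cls (below q))^-1 * cls (projT1 (cid h))))^-1
  else psi ((cls (upto p))^-1 * cls (below q)).

Lemma gap_cut i (p q : wdom (W i)) L :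
  (forall z, Z z -> ~ (p < z < q)%O) -> real g L -> L p -> ~ L q ->
  gap p q = phi ((cls (upto p))^-1 * cls L) * (phi ((cls (below q))^-1 * cls L))^-1.
Proof.
move=> noz rL Lp nLq; rewrite /gap; case: pselect => [h|[]]; last by exists L.
case: (cid h) => M /= [rM Mp nMq].
suff sub L1 L2 : real g L1 -> real g L2 -> L1 p -> ~ L2 q -> L2 `<=` L1.
  have -> : M = L by apply/seteqP; split; exact: sub.
  by [].
move=> r1 r2 L1p nL2q; apply: Z_sepE => // z Zz L2z.
apply: contrapT => nL1z; apply: (noz z Zz); rewrite !ltNge.
apply/andP; split; apply/negP => le.
  exact: nL1z (real_down r1 le L1p).
exact: nL2q (real_down r2 le L2z).
Qed.

Definition mval i (p : wdom (W i)) : G := psi ((cls (below p))^-1 * cls (upto p)).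

Fixpoint mprod i (p : wdom (W i)) (s : seq (wdom (W i))) : G :=
  mval p * (if s is q :: s' then gap p q * mprod q s' else 1).

Lemma mprod_cat i p s q t :
  @mprod i p (s ++ q :: t) = mprod p s * gap (last p s) q * mprod q t.
Proof.
elim: s p => [|r s IH] p /=; first by rewrite mulg1 !mulgA.
by rewrite IH !mulgA.
Qed.

(** The part before the first mark counts as the right half of a split gap, and the part after the
    last mark as a left half. A real cut containing no mark is empty, whence the value 1. *)
Definition om i (L : set (wdom (W i))) : G :=
  if [seq x <- marks i | `[< L x >]] is p :: s then
    (phi (cls (below p))^-1)^-1 * mprod p s * phi ((cls (upto (last p s)))^-1 * cls L)
  else 1.

Lemma om0 i : @om i set0 = 1.
Proof.
rewrite /om (_ : [seq x <- _ | _] = [::]) //.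
apply/eqP; rewrite -(negbK (_ == _)) -has_filter -all_predC.
by apply/allP => x _ /=; rewrite asboolF.
Qed.

Lemma omT i p s : marks i = p :: s -> @om i setT =
  (phi (cls (below p))^-1)^-1 * mprod p s * phi ((cls (upto (last p s)))^-1 * cls [set: wdom (W i)]).
Proof.
move=> e; rewrite /om (_ : [seq x <- _ | _] = p :: s) //.
by rewrite -e; apply/all_filterP/allP => x _; rewrite asboolT.
Qed.

Lemma marks_split i (L : set (wdom (W i))) :
  (forall x y, L y -> (x <= y)%O -> L x) ->
  marks i = [seq x <- marks i | `[< L x >]] ++ [seq x <- marks i | `[< ~ L x >]].
Proof.
move=> Ld; elim: (marks i) (marks_sorted i) => //= x s IH /andP[/allP xs ps].
have [Lx|nLx] := pselect (L x).
  by rewrite asboolT // asboolF /= -?IH //; apply.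
rewrite asboolF // asboolT //.
have -> : [seq x <- s | `[< L x >]] = [::].
  apply/eqP; rewrite -(negbK (_ == _)) -has_filter -all_predC.
  apply/allP => y ys /=; apply/negP => /asboolP Ly; apply: nLx.
  by apply: (Ld _ _ Ly); apply/ltW/xs.
rewrite /=; congr cons; apply/esym/all_filterP/allP => y ys; apply/asboolP => Ly.
by apply: nLx; apply: (Ld _ _ Ly); apply/ltW/xs.
Qed.

Lemma marks_adjacent i s1 p q s2 : marks i = s1 ++ p :: q :: s2 ->
  forall z, Z z -> ~ (p < z < q)%O.
Proof.
move=> e z Zz /andP[pz zq].
have : z \in marks i by rewrite mem_marks; apply/asboolP.
have := marks_sorted i; rewrite e pairwise_cat !pairwise_cons.
move=> /and3P[/allrelP r1 _ /and3P[_ /allP qs _]].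
rewrite mem_cat !inE => /or4P[zs|/eqP zp|/eqP zq'|zs].
- by have := r1 _ p zs (mem_head _ _); rewrite ltNge (ltW pz).
- by rewrite zp ltxx in pz.
- by rewrite zq' ltxx in zq.
- by have := qs z zs; rewrite ltNge (ltW zq).
Qed.

(** The cut [L] splits the gap between the last mark in it and the first mark [a] after it: the left
    half completes [om L], and the right half begins the remainder. *)
Lemma om_split i (L : set (wdom (W i))) a s : real g L ->
  [seq x <- marks i | `[< ~ L x >]] = a :: s ->
  @om i setT = om L * (phi ((cls (below a))^-1 * cls L))^-1 * mprod a s *
    phi ((cls (upto (last a s)))^-1 * cls [set: wdom (W i)]).
Proof.
move=> rL e; have Ld x y : L y -> (x <= y)%O -> L x.
  by move=> Ly xy; exact: real_down rL _ _ xy Ly.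
have ma : a \in [seq x <- marks i | `[< ~ L x >]] by rewrite e mem_head.
have nLa : ~ L a by move: ma; rewrite mem_filter => /andP[/asboolP].
have := marks_split Ld; rewrite e.
case F : [seq x <- marks i | `[< L x >]] => [|c s1] mE.
  have L0 : L = set0.
    apply/seteqP; split => //; apply: Z_sepE => //; first exact: real0.
    move=> z Zz Lz; have : z \in [seq x <- marks i | `[< L x >]].
      by rewrite mem_filter mem_marks !asboolT.
    by rewrite F.
  by rewrite (omT mE) L0 om0 cls0 mulg1 mul1g.
have Ld' : L (last c s1).
  have : last c s1 \in [seq x <- marks i | `[< L x >]] by rewrite F mem_last.
  by rewrite mem_filter => /andP[/asboolP].
have adj : forall z, Z z -> ~ (last c s1 < z < a)%O.
  by apply: (@marks_adjacent i (belast c s1) _ _ s); rewrite mE lastI cat_rcons.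
rewrite (omT mE) last_cat /= mprod_cat (gap_cut adj rL Ld' nLa).
by rewrite [om L]/om F !mulgA.
Qed.

(** A gluing exchanges the left half with the inverse of the right half, which inverts the quotient
    of the values of [phi]. A gap is split by a real cut exactly when its image is, by transport in
    both directions. *)
Lemma gap_gmap k (a q : wdom (W (gsrc (g k)))) : U k a -> U k q ->
  (forall z, Z z -> ~ (a < z < q)%O) -> gap (tau k q) (tau k a) = (gap a q)^-1.
Proof.
move=> Ua Uq noz.
have noz' z : Z z -> ~ (tau k q < z < tau k a)%O.
  move=> Zz /andP[qz za]; have [r Ur rz] := gcod_down Ua (ltW za).
  apply: (noz r); first by apply/Z_gmap => //; rewrite rz.
  by move: qz za; rewrite -rz !ltNge !gmap_anti_le // => -> ->.
have [[L [rL La nLq]]|nL] := pselect (exists L, [/\ real g L, L a & ~ L q]).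
  have UL : ~` U k `<=` L.
    by have [//|LU] := real_total (real_dom g k) rL; have := LU a La.
  have Ld x y : L y -> (x <= y)%O -> L x.
    by move=> Ly xy; exact: real_down rL _ _ xy Ly.
  rewrite (gap_cut noz rL La nLq) (gap_cut noz' (real_fwd rL UL)); first last.
  - by move=> [r [Ur nLr]] /(gmap_inj Ur Ua) ra; rewrite ra in nLr.
  - by exists q.
  rewrite cls_upto_gmap // cls_below_gmap // cls_gmap // !invgM !invgK.
  by rewrite !mulgA !mulgK.
rewrite /gap; case: pselect => [[L [rL Lq nLa]]|_].
  exfalso; apply: nL.
  have LD : L `<=` tau k @` U k.
    have [//|DL] := real_total rL (real_cod g k).
    by case: nLa; apply: DL; exists a.
  exists [set p | U k p -> ~ L (tau k p)]; split; first exact: real_bwd.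
  - by [].
  - by move=> /(_ Uq).
case: pselect => [/nL//|_].
by rewrite -psiV cls_upto_gmap // cls_below_gmap // !invgM !invgK mulgA mulgK.
Qed.

Lemma mval_gmap k p : U k p -> mval (tau k p) = (mval p)^-1.
Proof.
move=> Up; rewrite /mval -psiV cls_upto_gmap // cls_below_gmap //.
by rewrite !invgM !invgK mulgA mulgK.
Qed.

Lemma mprod_gmap k (a : wdom (W (gsrc (g k)))) s s0 :
  marks _ = s0 ++ a :: s -> {in a :: s, forall x, U k x} ->
  exists t, [seq tau k x | x <- rev (a :: s)] = tau k (last a s) :: t /\
    last (tau k (last a s)) t = tau k a /\
    mprod (tau k (last a s)) t = (mprod a s)^-1.
Proof.
elim: s a s0 => [|q s IH] a s0 mE Us.
  exists [::]; split=> //; split=> //=.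
  by rewrite !mulg1 mval_gmap //; apply: Us; exact: mem_head.
have [||t [tE [tl tp]]] := IH q (rcons s0 a).
- by rewrite cat_rcons.
- by move=> x xs; apply: Us; rewrite inE xs orbT.
have Ua : U k a by apply: Us; exact: mem_head.
have Uq : U k q by apply: Us; rewrite !inE eqxx orbT.
exists (t ++ [:: tau k a]); rewrite rev_cons map_rcons tE cats1 /=.
split=> //; rewrite last_rcons; split => //.
rewrite -cats1 mprod_cat tl tp (gap_gmap Ua Uq (marks_adjacent mE)) /= mulg1.
by rewrite mval_gmap // !invgM ?mulgA.
Qed.

Lemma marks_cod k :
  [seq x <- marks (gdst (g k)) | `[< (tau k @` U k) x >]] =
  [seq tau k x | x <- rev [seq x <- marks (gsrc (g k)) | `[< ~ (~` U k) x >]]].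
Proof.
apply: lt_sorted_eq.
- rewrite sorted_filter //; [exact: lt_trans|].
  by rewrite sorted_pairwise; [exact: marks_sorted|exact: lt_trans].
- rewrite map_rev rev_sorted sorted_pairwise; last first.
    by move=> x y z yx xz; exact: lt_trans xz yx.
  rewrite pairwise_map.
  apply: (@sub_in_pairwise _ [pred x | `[< ~ (~` U k) x >]] <%O).
  + move=> x y /= /(@asboolP (~ ~ _))/contrapT Ux /(@asboolP (~ ~ _))/contrapT Uy.
    exact: (gmap_anti Ux Uy).
  + exact: filter_all.
  + exact: pairwise_filter (marks_sorted _).
- move=> y; rewrite mem_filter mem_marks; apply/andP/mapP.
    move=> [/asboolP[p Up py] /asboolP Zy]; exists p => //.
    rewrite mem_rev mem_filter mem_marks; apply/andP.
    by split; apply/asboolP; [apply|apply/Z_gmap => //; rewrite py].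
  move=> [p]; rewrite mem_rev mem_filter mem_marks => /andP[/asboolP nnUp /asboolP Zp] ->.
  have Up := contrapT nnUp.
  by split; apply/asboolP; [exists p|apply/Z_gmap].
Qed.

Lemma om_cons i (L : set (wdom (W i))) p s :
  [seq x <- marks i | `[< L x >]] = p :: s ->
  om L = (phi (cls (below p))^-1)^-1 * mprod p s * phi ((cls (upto (last p s)))^-1 * cls L).
Proof. by rewrite /om => ->. Qed.

(** The marks of the image are those of [gdom] in reverse order, so the product over them is
    inverted; [om_split] at the real cut where [gdom] begins provides the remaining factors. *)
Lemma om_respects k : respects om (g k).
Proof.
rewrite /respects; set i := gsrc (g k).
have rU : real g (~` U k) by exact: real_dom.
have codE := marks_cod k.
case F : [seq x <- marks i | `[< ~ (~` U k) x >]] => [|a s].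
  have UT : ~` U k = setT.
    apply/seteqP; split => //; apply: Z_sepE => //; first exact: realT.
    move=> z Zz _; apply: contrapT => nUz.
    have : z \in [seq x <- marks i | `[< ~ (~` U k) x >]].
      by rewrite mem_filter mem_marks !asboolT.
    by rewrite F.
  rewrite UT mulVg mul1g (_ : U k = set0) ?image_set0 ?om0 //.
  by rewrite -[U k]setCK UT setCT.
have mE : marks i = [seq x <- marks i | `[< (~` U k) x >]] ++ a :: s.
  by rewrite -F; apply: marks_split => x y nUy xy Ux; apply: nUy; exact: gdom_up Ux.
have Us : {in a :: s, forall x, U k x}.
  by move=> x; rewrite -F mem_filter => /andP[/(@asboolP (~ ~ _))/contrapT].
have [t [tE [tl tp]]] := mprod_gmap mE Us.
rewrite F tE in codE.
have Ua : U k a by apply: Us; exact: mem_head.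
have Ul : U k (last a s) by apply: Us; exact: mem_last.
rewrite (om_cons codE) tl tp cls_cod cls_upto_gmap // cls_below_gmap // (om_split rU F).
by rewrite !invgM !invgK !mulgA mulVg mul1g !mulgK mulVg.
Qed.

(** Every factor becomes a quotient of values of [psi] on initial segments, and the product
    telescopes. *)
Lemma om_mem i : real g [set: wdom (W i)] ->
  cls [set: wdom (W i)] \in S ->
  (forall p : wdom (W i), cls (below p) \in S /\ cls (upto p) \in S) ->
  @om i setT = psi (cls [set: wdom (W i)]).
Proof.
move=> rT ST Sp.
have phiS x : x \in S -> phi x = psi x by move=> Sx; rewrite -[x]mulg1 phiM // phi1 mulg1 mulg1.
have Sb (p : wdom (W i)) : cls (below p) \in S by have [] := Sp p.
have Su (p : wdom (W i)) : cls (upto p) \in S by have [] := Sp p.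
have psiVM x y : x \in S -> y \in S -> psi (x^-1 * y) = (psi x)^-1 * psi y.
  by move=> Sx Sy; rewrite psiM ?psiV //; exact: S_inv.
have mprodE p s : @mprod i p s = (psi (cls (below p)))^-1 * psi (cls (upto (last p s))).
  elim: s p => [|q s IH] p /=; first by rewrite mulg1 /mval psiVM.
  have -> : gap p q = (psi (cls (upto p)))^-1 * psi (cls (below q)).
    rewrite -psiVM // /gap; case: pselect => // h; set c := projT1 _.
    (* The class of the cut [c] may lie outside [S], but the two arguments of [phi] differ by a left
       factor in [S], so equivariance removes [c]. *)
    rewrite -{1}(mulVKg (cls (below q)) (cls c)) mulgA phiM ?mulgK //.
    by apply: S_mul => //; exact: S_inv.
  by rewrite IH /mval psiVM // !mulgA mulgK mulgK.
case E : (marks i) => [|p s].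
  have T0 : [set: wdom (W i)] = set0.
    apply/seteqP; split => //; apply: Z_sepE => //; first exact: real0.
    move=> z Zz _; have : z \in marks i by rewrite mem_marks asboolT.
    by rewrite E.
  by rewrite T0 om0 cls0 psi1.
rewrite (omT E) phiS; last exact: S_inv.
rewrite psiV invgK mprodE phiS; last by apply: S_mul => //; exact: S_inv.
by rewrite psiVM // !mulgA mulgK mulgV mul1g.
Qed.
End Potential.

(** * Finite systems and compactness *)

Section FiniteSolution.
Local Open Scope group_scope.
Variables (A : countType) (G : groupType) (S : {pred BF A}) (psi phi : BF A -> G).
Hypothesis tameS : tame S.
Hypothesis S_mul : forall x y, x \in S -> y \in S -> x * y \in S.
Hypothesis S_inv : forall x, x \in S -> x^-1 \in S.
Hypothesis psiM : forall x y, x \in S -> y \in S -> psi (x * y) = psi x * psi y.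
Hypothesis psi1 : psi 1 = 1.
Hypothesis psiV : forall x, psi x^-1 = (psi x)^-1.
Hypothesis phi1 : phi 1 = 1.
Hypothesis phiM : forall h x, h \in S -> phi (h * x) = psi h * phi x.

Lemma below_upto_tame w : reduced w -> \pi_(BF A) w \in S -> forall z : wdom w,
  cls [set x | (x < z)%O] \in S /\ cls [set x | (x <= z)%O] \in S.
Proof.
move=> rw Sw z; have Su := cls_prefix_tame S_mul S_inv tameS rw Sw z.
split=> //; have : cls [set x : wdom w | (x <= z)%O] =
    cls [set x : wdom w | (x < z)%O] * \pi_(BF A) (subword z z).
  rewrite (@cls_split _ w [set x | (x < z)%O]).
  - congr (_ * cls _); rewrite predeqE => x; rewrite in_witv; split.
      by move=> [/= xz /negP]; rewrite -leNgt => zx; apply/andP.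
    by move=> /andP[zx xz]; split => //; apply/negP; rewrite -leNgt.
  - by move=> x y /= yz xy; exact: le_lt_trans xy yz.
  - by move=> x /ltW.
move=> e; rewrite -(mulgK (\pi_(BF A) (subword z z)) (cls _)) -e.
apply: S_mul => //; apply: S_inv; exact: tameS.
Qed.

(** All gluings of all triples from [E] with product 1 form one finite system. The memberships asked
    for in the second clause make [(x, x^-1, 1)] one of these triples, so that a gluing starts from
    the word of [x] and its end is a real cut, as [om_mem] requires. *)
Lemma finite_solution (E : seq (BF A)) : exists F : BF A -> G,
  (forall x y z, x \in E -> y \in E -> z \in E -> x * y * z = 1 ->
    F x * F y * F z = 1) /\
  (forall x, x \in S -> 1 \in E -> x \in E -> x^-1 \in E -> F x = psi x).
Proof.
have /choice[W WP] : forall x : BF A, exists w, reduced w /\ \pi_(BF A) w = x.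
  move=> x; have [w rw xw] := exists_reduced (repr x); exists w; split => //.
  by rewrite -[RHS]reprK; apply/esym/BF_eqP.
have Wred x : reduced (W x) by have [] := WP x.
have piW x : \pi_(BF A) (W x) = x by have [] := WP x.
pose TT := [seq t <- [seq (xy, z) | xy <- [seq (x, y) | x <- E, y <- E], z <- E]
  | t.1.1 * t.1.2 * t.2 == 1].
have TP x y z : x \in E -> y \in E -> z \in E -> x * y * z = 1 -> (x, y, z) \in TT.
  move=> xE yE zE /eqP e; rewrite mem_filter e.
  by apply/allpairsP; exists ((x, y), z); split => //; apply/allpairsP; exists (x, y).
pose T := 'I_(size TT).
pose tr (t : T) := tnth (in_tuple TT) t.
have /choice[h hP] : forall t : T, exists h : option bool -> gluing W,
    gsrc (h None) = (tr t).1.1 /\ forall om : forall i, set (wdom (W i)) -> G,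
      (forall k, om k set0 = 1) -> (forall r, respects om (h r)) ->
      om (tr t).1.1 setT * om (tr t).1.2 setT * om (tr t).2 setT = 1.
  move=> t; have : tr t \in TT by exact: mem_tnth.
  rewrite mem_filter => /andP[/eqP xyz _]; move: (tr t) xyz => [[x y] z] /= xyz.
  have /BF_eqP/wequiv_empty_pairing st :
      \pi_(BF A) (wcat (W x) (wcat (W y) (W z))) = \pi_(BF A) (wempty A).
    by rewrite -!BF_mulE !piW mulgA xyz.
  have [h1 [h2 [h3 [h1x _ _ hP]]]] := triple_gluings G (Wred x) (Wred y) (Wred z) st.
  exists (fun r => match r with None => h1 | Some true => h2 | Some false => h3 end).
  split=> // om om0 r; apply: hP => //.
  - exact: (r None).
  - exact: (r (Some true)).
  - exact: (r (Some false)).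
pose g (k : T * option bool) : gluing W := h k.1 k.2.
have [Z [Zfin Zmap Zsep]] := exists_marks g Wred.
pose F x := om g Z psi phi [set: wdom (W x)]; exists F.
have FP t : F (tr t).1.1 * F (tr t).1.2 * F (tr t).2 = 1.
  have [_ H] := hP t; apply: H => [i|r]; first exact: om0.
  exact: (om_respects Zfin Zmap Zsep phi psiV (t, r)).
have trP x y z : x \in E -> y \in E -> z \in E -> x * y * z = 1 ->
    exists t, tr t = (x, y, z).
  move=> xE yE zE /(TP x y z xE yE zE)/(tnthP (in_tuple TT))[t e]; by exists t.
split=> [x y z xE yE zE xyz|x Sx oneE xE xVE].
  by have [t e] := trP x y z xE yE zE xyz; have := FP t; rewrite e.
have rT : real g [set: wdom (W x)].
  have [|t e] := trP x x^-1 1 xE xVE oneE; first by rewrite mulgV mulg1.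
  have [+ _] := hP t; rewrite e /= => <-; exact: (realT g (t, None)).
have Sw : \pi_(BF A) (W x) \in S by rewrite piW.
rewrite /F (om_mem Zfin Zsep S_mul S_inv psiM psi1 psiV phi1 phiM rT).
- by rewrite clsT piW.
- by rewrite clsT.
- by move=> p; exact: (below_upto_tame (Wred x) Sw p).
Qed.
End FiniteSolution.

Lemma ultra_fmap (T U : Type) (f : T -> U) (F : set_system T) :
  UltraFilter F -> UltraFilter (f x @[x --> F]).
Proof.
move=> UF; split=> [|H HH sFH]; first exact: fmap_proper_filter.
apply/seteqP; split => // B HB.
have [//|FnB] := in_ultra_setVsetC (f @^-1` B) UF.
have HnB : H (~` B) by apply: (sFH (~` B)); exact: FnB.
by have [y []] := filter_ex (filterI HB HnB).
Qed.

(** * From finite systems to a homomorphism on the whole group *)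

Section Compactness.
Local Open Scope group_scope.
Variables (B : groupType) (G : topologicalGroupType).
Hypothesis compactG : compact [set: G].
Hypothesis hausdorffG : hausdorff_space G.
Variables (P : {pred B}) (psi : B -> G).

(** The ultrafilter contains, for each [E0], the lists including [E0], so every single relation
    holds at almost all [E] and survives in the limit. The triples [(x, x^-1, 1)] give inverses, and
    then [(x, y, (x * y)^-1)] gives multiplicativity. *)
Lemma compact_hom_extension :
  (forall E : seq B, exists F : B -> G,
    (forall x y z, x \in E -> y \in E -> z \in E -> x * y * z = 1 ->
      F x * F y * F z = 1) /\
    (forall x, x \in P -> 1 \in E -> x \in E -> x^-1 \in E -> F x = psi x)) ->
  1 \in P -> psi 1 = 1 ->
  exists F : B -> G, {morph F : x y / x * y} /\ {in P, F =1 psi}.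
Proof.
move=> /choice[F FP] P1 psi1.
pose cone (E0 : seq B) := [set E : seq B | {subset E0 <= E}].
have [U [UU coneU]] : exists U, UltraFilter U /\ filter_from setT cone `<=` U.
  apply: ultraFilterLemma; apply: filter_from_proper => [|E0 _].
    apply: filter_from_filter => [|E1 E2 _ _]; first by exists [::].
    exists (E1 ++ E2) => // E sE; split=> x xE; apply: sE; rewrite mem_cat xE ?orbT //.
  by exists E0 => x.
have Umem (E0 : seq B) (Q : seq B -> Prop) : (forall E, {subset E0 <= E} -> Q E) -> U Q.
  by move=> h; apply: coneU; exists E0.
have /choice[L LP] : forall x : B, exists l : G, (F E x @[E --> U] --> l).
  move=> x; move: compactG; rewrite compact_ultra.
  have UF := ultra_fmap (F ^~ x) UU.
  by move=> /(_ _ UF)[|l [_ Ll]]; [exact: filterT|exists l].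
have limE x l : U [set E | F E x = l] -> L x = l.
  move=> Ul; apply: (cvg_unique hausdorffG (LP x)).
  apply: cvg_trans (@cvg_cst _ l _ U _); apply: near_eq_cvg.
  by apply: filterS Ul => E /= ->.
have LE x : x \in P -> L x = psi x.
  move=> Px; apply: limE; apply: (Umem [:: 1; x; x^-1]) => E sE.
  by apply: (FP E).2 => //; apply: sE; rewrite !inE eqxx ?orbT.
have L1 : L 1 = 1 by rewrite LE.
have mulc (f h : seq B -> G) a b : f E @[E --> U] --> a -> h E @[E --> U] --> b ->
    f E * h E @[E --> U] --> a * b.
  move=> fa hb; apply: (@continuous2_cvg _ _ _ _ U _ f h (fun x y => x * y)) => //.
  exact: (@mulg_continuous G (a, b)).
have L3 x y z : x * y * z = 1 -> L x * L y * L z = 1.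
  move=> xyz; apply: (@cvg_unique _ hausdorffG (F E x * F E y * F E z @[E --> U])).
    exact: mulc (mulc _ _ _ _ (LP x) (LP y)) (LP z).
  apply: cvg_trans (@cvg_cst _ (1 : G) _ U _); apply: near_eq_cvg.
  apply: (Umem [:: x; y; z]) => E sE /=; apply/esym/(FP E).1 => //;
    by apply: sE; rewrite !inE eqxx ?orbT.
have LV x : L x^-1 = (L x)^-1.
  have := L3 x x^-1 1; rewrite mulgV mulg1 L1 mulg1 => /(_ erefl)/eqP.
  by rewrite mulg_eq1 => /eqP ->; rewrite invgK.
exists L; split=> [x y|x Px]; last exact: LE.
have := L3 x y (x * y)^-1; rewrite mulgV LV => /(_ erefl)/eqP.
by rewrite mulg_eq1 invgK => /eqP.
Qed.
End Compactness.

Theorem mainTheorem1 (A : countType) (S : {pred BF A}) (H : subGroupType S)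
    (tameH : tame S) (G : topologicalGroupType)
    (compactG : compact [set: G]%classic) (hausdorffG : hausdorff_space G)
    (f : {multiplicative H -> G}) :
  exists F : {multiplicative BF A -> G}, forall x : H, F (\val x) = f x.
Proof.
have SH x : x \in S -> exists h : H, \val h = x.
  by move=> Sx; case: (insubP H x) => [h _ <-|/negP[]]; [exists h|].
have HS (h : H) : \val h \in S by exact: valP.
have S_mul x y : x \in S -> y \in S -> (x * y)%g \in S.
  move=> /SH[a <-] /SH[b <-]; rewrite -gmulfM; exact: HS.
have S_inv x : x \in S -> (x^-1)%g \in S.
  move=> /SH[a <-]; rewrite -gmulfV; exact: HS.
have S_one : (1 : BF A)%g \in S by have -> : (1 : BF A)%g = \val (1 : H)%g; [rewrite gmulf1|exact: HS].
(* The value 1 outside [S] makes [psi] compatible with inverses everywhere. *)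
pose psi (x : BF A) : G := if insub x is Some h then f (h : H) else 1%g.
have psi_val h : psi (\val h) = f h by rewrite /psi valK.
have psiM x y : x \in S -> y \in S -> psi (x * y)%g = (psi x * psi y)%g.
  by move=> /SH[a <-] /SH[b <-]; rewrite -gmulfM !psi_val gmulfM.
have psi1 : psi 1%g = 1%g.
  by apply: (@mulgI _ (psi 1%g)); rewrite -psiM // !mulg1.
have psiV x : psi (x^-1)%g = ((psi x)^-1)%g.
  have [Sx|nSx] := boolP (x \in S).
    apply: (@mulgI _ (psi x)); rewrite -psiM ?mulgV ?psi1 //; exact: S_inv.
  rewrite /psi !insubF ?invg1 //; first exact: negbTE.
  by apply/negbTE/negP => /S_inv; rewrite invgK; exact/negP.
(* [rep x] is a representative of the coset of elements [h * x] with [h] in [S]. It depends on the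
   coset only and is 1 on [S], whence the equivariance of [phi] and [phi 1 = 1]. *)
pose rep (x : BF A) := if x \in S then 1%g else xget 1%g [set y | (x * y^-1)%g \in S].
pose phi x := psi (x * (rep x)^-1)%g.
have repS x : (x * (rep x)^-1)%g \in S.
  rewrite /rep; case: ifP => [Sx|_]; first by rewrite invg1 mulg1.
  by case: xgetP => [y -> //|/(_ x)]; rewrite /= mulgV.
have mulS h x : h \in S -> ((h * x)%g \in S) = (x \in S).
  move=> Sh; apply/idP/idP => [|Sx]; last exact: S_mul.
  by move=> /(S_mul _ _ (S_inv _ Sh)); rewrite mulKg.
have phiM h x : h \in S -> phi (h * x)%g = (psi h * phi x)%g.
  move=> Sh; rewrite /phi; have -> : rep (h * x)%g = rep x.
    rewrite /rep mulS //; case: ifP => // _; congr xget.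
    by apply/seteqP; split => y /=; rewrite -mulgA (mulS h).
  by rewrite -mulgA (psiM h).
have phi1 : phi 1%g = 1%g by rewrite /phi /rep S_one invg1 mulg1.
have [F [FM Fpsi]] := compact_hom_extension compactG hausdorffG
  (finite_solution tameH S_mul S_inv psiM psi1 psiV phi1 phiM) S_one psi1.
pose FB := isMultiplicative.Build _ _ F FM.
pose Fm : {multiplicative BF A -> G} := HB.pack F FB.
by exists Fm => x; rewrite -psi_val; exact: Fpsi.
Qed.
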